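(* Let $n\ge 1$ be an integer, $p,q\in[1,\infty)$ and $\lambda,\sigma,\alpha,\beta\in(0,\infty)$. Assume that $$\left(p>1\text{ and }0<\alpha<\tfrac{n+2}{2p}\right)\ \text{ or }\ \left(p=1\text{ and }0<\alpha\le\tfrac{n+2}{2p}\right),$$ $$\left(q>1\text{ and }0<\beta<\tfrac{n+2}{2q}\right)\ \text{ or }\ \left(q=1\text{ and }0<\beta\le\tfrac{n+2}{2q}\right),$$ and $\sigma<1/\lambda$. Define $$\gamma_1=\frac{(\beta+\alpha\sigma)\lambda}{1-\lambda\sigma},\qquad\gamma_2=\frac{(\alpha+\beta\lambda)\sigma}{1-\lambda\sigma},$$ $$M_1=\frac{\Gamma(\gamma_1+1)\Gamma(\gamma_2+1)^{1/\sigma}}{\Gamma(\alpha+\gamma_1+1)\Gamma(\beta+\gamma_2+1)^{1/\sigma}},\qquad M_2=\frac{\Gamma(\gamma_2+1)\Gamma(\gamma_1+1)^{1/\lambda}}{\Gamma(\beta+\gamma_2+1)\Gamma(\alpha+\gamma_1+1)^{1/\lambda}},$$ where $\Gamma$ is the Gamma function. Let $T>0$, $0<N_1<M_1$ and $0<N_2<M_2$. Then there exist solutions $$u\in Y^p_\alpha\cap C(\mathbb{R}^n\times\mathbb{R})\quad\text{and}\quad v\in Y^q_\beta\cap C(\mathbb{R}^n\times\mathbb{R})$$ of $$0\le(\partial_t-\Delta)^\alpha u\le v^\lambda,\qquad 0\le(\partial_t-\Delta)^\beta v\le u^\sigma\qquad\text{in }\mathbb{R}^n\times\mathbb{R},$$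 $$u=v=0\quad\text{in }\mathbb{R}^n\times(-\infty,0),$$ such that for $0<t<T$ $$u(0,t)\ge N_2^{\frac{\lambda}{1-\lambda\sigma}}t^{\gamma_2/\sigma}\quad\text{and}\quad v(0,t)\ge N_1^{\frac{\sigma}{1-\lambda\sigma}}t^{\gamma_1/\lambda}.$$
   Context: For $p\ge1$, $X^p:=\bigcap_{T\in\mathbb{R}}L^p(\mathbb{R}^n\times(-\infty,T))$, i.e. the set of measurable $f:\mathbb{R}^n\times\mathbb{R}\to\mathbb{R}$ with $\|f\|_{L^p(\mathbb{R}^n\times(-\infty,T))}<\infty$ for all $T\in\mathbb{R}$ (functions equal a.e. are identified). For $\alpha>0$ the fractional heat kernel is $$\Phi_\alpha(x,t):=\frac{t^{\alpha-1}}{\Gamma(\alpha)}\frac{1}{(4\pi t)^{n/2}}e^{-|x|^2/(4t)}\chi_{(0,\infty)}(t),$$ and $$J_\alpha f(x,t):=\iint_{\mathbb{R}^n\times(-\infty,t)}\Phi_\alpha(x-\xi,t-\tau)f(\xi,\tau)\,d\xi\,d\tau .$$ Set $Y^p_\alpha:=J_\alpha(X^p)$. When ($p>1$ and $0<\alpha<\frac{n+2}{2p}$) or ($p=1$ and $0<\alpha\le\frac{n+2}{2p}$), it is known that $J_\alpha f\in L^p_{\rm loc}(\mathbb{R}^n\times\mathbb{R})$ for $f\in X^p$ and that $J_\alpha:X^p\to Y^p_\alpha$ is one-to-one and onto; the fully fractional heat operator $(\partial_t-\Delta)^\alpha:Y^p_\alpha\to X^p$ is defined as the inverse of $J_\alpha:X^p\to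 Y^p_\alpha$. Likewise $(\partial_t-\Delta)^\beta:Y^q_\beta\to X^q$ is the inverse of $J_\beta:X^q\to Y^q_\beta$. *)

(* Defs.v *)
From HB Require Import structures.
From mathcomp Require Import all_boot all_order all_algebra.
From mathcomp Require Import all_classical all_reals all_analysis.
From mathcomp Require Import measurable_realfun.

Set Implicit Arguments.
Unset Strict Implicit.
Unset Printing Implicit Defensive.
Import Order.TTheory GRing.Theory Num.Theory.
Import numFieldNormedType.Exports.
Local Open Scope classical_set_scope.
Local Open Scope ring_scope.

(* R^n is 'rV[R]_n with its Borel sigma-algebra, which is generated by the
   coordinates (as the library does for tuples). *)
Section measurable_rV.
Context {R : realType} {n : nat}.

Let coord (i : 'I_n) (x : 'rV[R]_n) : R := x ord0 i.

Let rV_set0 : g_sigma_preimage coord set0.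
Proof. exact: sigma_algebra0. Qed.

Let rV_setC A : g_sigma_preimage coord A -> g_sigma_preimage coord (~` A).
Proof. exact: sigma_algebraC. Qed.

Let rV_bigcup (F : _^nat) : (forall i, g_sigma_preimage coord (F i)) ->
  g_sigma_preimage coord (\bigcup_i (F i)).
Proof. exact: sigma_algebra_bigcup. Qed.

Definition measure_rV_display : measure_display -> measure_display.
Proof. exact. Qed.

HB.instance Definition _ := @isMeasurable.Build
  (measure_rV_display default_measure_display) 'rV[R]_n
  (g_sigma_preimage coord) rV_set0 rV_setC rV_bigcup.

End measurable_rV.

Definition rV_cons (R : realType) (n : nat) (z : R * 'rV[R]_n) : 'rV[R]_n.+1 :=
  row_mx z.1%:M z.2 : 'rV[R]_(1 + n).

Section measurable_rV_cons.
Context {R : realType}.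

Lemma measurable_coord n (i : 'I_n) :
  measurable_fun [set: 'rV[R]_n] (fun x => x ord0 i).
Proof.
move=> _ Y mY; rewrite setTI; apply: sub_sigma_algebra => /=.
rewrite -bigcup_seq/=; exists i => /=; first by rewrite mem_index_enum.
by exists Y => //; rewrite setTI.
Qed.

Lemma measurable_fun_coordP d (T : measurableType d) n (f : T -> 'rV[R]_n) :
  measurable_fun [set: T] f <->
  forall i, measurable_fun [set: T] (fun x => f x ord0 i).
Proof.
split=> [mf i|mf _ Y mY].
  exact: (measurableT_comp (measurable_coord i)).
rewrite setTI.
pose G : set (set 'rV[R]_n) := [set A | measurable (f @^-1` A)].
suff : (measurable : set (set 'rV[R]_n)) `<=` G by apply.
apply: smallest_sub.
  split => /=.
  - by rewrite /G /= preimage_set0; exact: measurable0.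
  - move=> A; rewrite /G /= => mA; rewrite setTD preimage_setC.
    exact: measurableC.
  - move=> F mF; rewrite /G /= preimage_bigcup.
    exact: bigcupT_measurable.
rewrite -bigcup_seq => A [i _ [B mB <-]].
rewrite /G /= setTI -[X in measurable X]setTI.
by have := mf i measurableT _ mB.
Qed.

Lemma rV_cons0 n (z : R * 'rV[R]_n) : rV_cons z ord0 ord0 = z.1.
Proof.
transitivity (row_mx z.1%:M z.2 ord0 (lshift n (ord0 : 'I_1))).
  by congr (row_mx _ _ _ _); exact: val_inj.
by rewrite row_mxEl mxE eqxx mulr1n.
Qed.

Lemma rV_cons_lift n (z : R * 'rV[R]_n) i :
  rV_cons z ord0 (lift ord0 i) = z.2 ord0 i.
Proof.
transitivity (row_mx z.1%:M z.2 ord0 (rshift 1 i)); last by rewrite row_mxEr.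
by congr (row_mx _ _ _ _); exact: val_inj.
Qed.

Lemma measurable_rV_cons n :
  measurable_fun [set: R * 'rV[R]_n] (@rV_cons R n).
Proof.
apply/measurable_fun_coordP => i.
have [j ->|->] := unliftP ord0 i.
  under eq_fun do rewrite rV_cons_lift.
  exact: (measurableT_comp (measurable_coord j)).
by under eq_fun do rewrite rV_cons0; exact: measurable_fst.
Qed.

Lemma rV_consK n : cancel (@rV_cons R n)
  (fun x => (x ord0 ord0, \row_i x ord0 (lift ord0 i))).
Proof.
move=> [t x]; rewrite rV_cons0; congr (_, _).
by apply/rowP => i; rewrite mxE rV_cons_lift.
Qed.

Lemma rV_consE n (x : 'rV[R]_n.+1) :
  rV_cons (x ord0 ord0, \row_i x ord0 (lift ord0 i)) = x.
Proof.
apply/rowP => i; have [j ->|->] := unliftP ord0 i; last by rewrite rV_cons0.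
by rewrite rV_cons_lift mxE.
Qed.

End measurable_rV_cons.

Definition lebesgue_cons (R : realType) (n : nat)
    (m : {sigma_finite_measure set 'rV[R]_n -> \bar R}) :
    set 'rV[R]_n.+1 -> \bar R :=
  pushforward (@lebesgue_measure R \x m)%E
    (@rV_cons R n : measurableTypeR R * 'rV[R]_n -> 'rV[R]_n.+1).

Section lebesgue_cons_measure.
Context {R : realType} {n : nat}.
Variable m : {sigma_finite_measure set 'rV[R]_n -> \bar R}.

HB.instance Definition _ := Measure.copy (lebesgue_cons m)
  (measure_function_pushforward__canonical__measure_function_Measure
    (@lebesgue_measure R \x m)%E (@measurable_rV_cons R n)).

Let lebesgue_cons_sigma_finite : sigma_finite setT (lebesgue_cons m).
Proof.
have /sigma_finiteP[F [FT ndF Foo]] := sigma_finiteT (@lebesgue_measure R).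
have /sigma_finiteP[G [GT ndG Goo]] := sigma_finiteT m.
pose g (x : 'rV[R]_n.+1) : 'rV[R]_n := \row_i x ord0 (lift ord0 i).
have mg : measurable_fun setT g.
  apply/measurable_fun_coordP => i; rewrite /g.
  by under eq_fun do rewrite mxE; exact: measurable_coord.
have mc := @measurable_coord R n.+1 ord0.
pose h (x : 'rV[R]_n.+1) : R := x ord0 ord0.
exists (fun i => h @^-1` F i `&` g @^-1` G i).
  apply/esym/seteqP; split => // x _.
  have [i _ Fi] : (\bigcup_i F i) (h x) by rewrite -FT.
  have [j _ Gj] : (\bigcup_i G i) (g x) by rewrite -GT.
  exists (maxn i j) => //; split.
    by have /subsetPset := ndF i (maxn i j) (leq_maxl _ _); apply.
  by have /subsetPset := ndG j (maxn i j) (leq_maxr _ _); apply.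
move=> i; have [mF Fi] := Foo i; have [mG Gi] := Goo i; split.
  apply: measurableI.
    by rewrite -[X in measurable X]setTI; exact: mc.
  by rewrite -[X in measurable X]setTI; exact: mg.
rewrite /lebesgue_cons /pushforward.
rewrite [X in (_ \x _)%E X](_ : _ = F i `*` G i); last first.
  by apply/funext => -[t x]; have [ht gx] := rV_consK (t, x);
    rewrite /h /g /= ht gx.
by rewrite product_measure1E// lte_mul_pinfty// ge0_fin_numE.
Qed.

HB.instance Definition _ := Measure_isSigmaFinite.Build _ _ _
  (lebesgue_cons m) lebesgue_cons_sigma_finite.

End lebesgue_cons_measure.

(* n-dimensional Lebesgue measure, as an iterated product of the
   one-dimensional one; lebesgue_rV_box characterizes it. *)
Fixpoint lebesgue_rV (R : realType) (n : nat) :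
    {sigma_finite_measure set 'rV[R]_n -> \bar R} :=
  match n with
  | 0 => \d_(0 : 'rV[R]_0)
  | n.+1 => lebesgue_cons (lebesgue_rV R n)
  end.

Lemma lebesgue_rV_box (R : realType) (n : nat) (A : 'I_n -> set R) :
  (forall i, measurable (A i)) ->
  lebesgue_rV R n [set x : 'rV[R]_n | forall i, A i (x ord0 i)] =
  (\prod_(i < n) lebesgue_measure (A i))%E.
Proof.
elim: n A => [|n IH] A mA.
  rewrite big_ord0 /= diracE mem_set//.
  by case.
rewrite big_ord_recl/= -IH//.
transitivity ((@lebesgue_measure R \x lebesgue_rV R n)%E
  (A ord0 `*` [set x : 'rV[R]_n | forall i, A (lift ord0 i) (x ord0 i)])).
  rewrite /lebesgue_cons /pushforward; congr (_ _).
  apply/seteqP; split => -[t x] /=.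
    move=> H; split; first by have := H ord0; rewrite rV_cons0.
    by move=> i; have := H (lift ord0 i); rewrite rV_cons_lift.
  move=> [H0 H] i; have [j ->|->] := unliftP ord0 i.
    by rewrite rV_cons_lift; exact: H.
  by rewrite rV_cons0.
rewrite product_measure1E//; first exact: mA.
rewrite (_ : [set _ | _] = \bigcap_i ((fun x : 'rV[R]_n => x ord0 i) @^-1`
  A (lift ord0 i))); last first.
  by apply/seteqP; split => x /= H; [move=> i _; exact: H | move=> i; exact: H].
apply: fin_bigcap_measurable => // i _.
by rewrite -[X in measurable X]setTI; apply: measurable_coord.
Qed.

Definition lebesgue_spacetime (R : realType) (n : nat) :
    {measure set ('rV[R]_n * measurableTypeR R) -> \bar R} :=
  (lebesgue_rV R n \x lebesgue_measure)%E.

Definition Gamma (R : realType) (s : R) : R :=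
  \int[lebesgue_measure]_(x in `]0, +oo[) (x `^ (s - 1) * expR (- x)).

Section fractional_heat.
Context {R : realType} {n : nat}.
Local Notation mu := (lebesgue_spacetime R n).
Implicit Types (p alpha : R) (f g u : 'rV[R]_n * R -> R).

(* The library norm on 'rV[R]_n is the sup norm, not the Euclidean one. *)
Definition sqnorm (x : 'rV[R]_n) : R := \sum_(i < n) x ord0 i ^+ 2.

Definition Xspace p : set ('rV[R]_n * R -> R) :=
  [set f : 'rV[R]_n * R -> R | measurable_fun [set: 'rV[R]_n * R] f /\
    forall T : R, finite_norm mu p%:E (fun z => if z.2 < T then f z else 0 : R)].

Definition frac_heat_kernel alpha (x : 'rV[R]_n) (t : R) : R :=
  if 0 < t then
    t `^ (alpha - 1) / Gamma alpha * ((4 * pi * t) `^ (n%:R / 2))^-1 *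
    expR (- (sqnorm x / (4 * t)))
  else 0.

(* Extended-real valued, because the integral is only known to be finite for
   almost every z. *)
Definition J alpha f (z : 'rV[R]_n * R) : \bar R :=
  (\int[mu]_(w in [set w | (w.2 < z.2)%R])
    (frac_heat_kernel alpha (z.1 - w.1) (z.2 - w.2) * f w)%:E)%E.

(* Functions equal almost everywhere are identified, so membership in the image
   of J alpha is equality almost everywhere with some J alpha f. *)
Definition Yspace p alpha : set ('rV[R]_n * R -> R) :=
  [set u | exists2 f, Xspace p f & \forall z \ae mu, (u z)%:E = J alpha f z].

(* is_frac_heat p alpha u f: f represents (d_t - Delta)^alpha u, i.e. f is the
   preimage of u under J alpha : Xspace p -> Yspace p alpha. This is the graph of
   the inverse of J alpha; f is determined by u up to almost everywhere
   equality when J alpha is injective on Xspace p. *)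
Definition is_frac_heat p alpha u f : Prop :=
  Xspace p f /\ \forall z \ae mu, (u z)%:E = J alpha f z.

End fractional_heat.

(* Main.v *)
(* With G1 = Gamma(gamma1+1)/Gamma(alpha+gamma1+1) and
   G2 = Gamma(gamma2+1)/Gamma(beta+gamma2+1), the
   functions A t^(alpha+gamma1) and B t^(beta+gamma2), A = M2^(lambda/(1-lambda sigma)),
   B = M1^(sigma/(1-lambda sigma)), solve the system with equality on t > 0, with
   sources (A/G1) t^gamma1 and (B/G2) t^gamma2. They are not integrable in x, so
   the sources are multiplied by Psi^lambda and Psi, where
   Psi(x,t) = exp(-e(|x|^2 + 2nt)). The heat semigroup satisfies
   exp(s Delta) exp(-c|x|^2) >= exp(-2ncs) exp(-c|x|^2), hence
   J_alpha(t^gamma1 Psi^lambda) >= G1 t^(alpha+gamma1) Psi^lambda for all t > 0, and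
   likewise for J_beta. This gives the first inequality of the system at once, and
   the second because Psi <= Psi^(lambda sigma). On (0,T) at x = 0 the loss Psi is as
   close to 1 as desired, which the gap between N_i and M_i allows. *)
Require Import Defs.
From mathcomp Require Import all_boot all_order all_algebra.
From mathcomp Require Import all_classical all_reals all_analysis.
From mathcomp Require Import measurable_realfun ring lra.

Set Implicit Arguments.
Unset Strict Implicit.
Unset Printing Implicit Defensive.
Import Order.TTheory GRing.Theory Num.Theory.
Import numFieldNormedType.Exports.
Local Open Scope classical_set_scope.
Local Open Scope ring_scope.

(** * Gamma and Beta integrals *)

Section affine.
Context {R : realType}.
Local Notation mu := (@lebesgue_measure R).

Lemma measurable_affine (k c : R) :
  measurable_fun [set: R] (fun x => k * x + c : measurableTypeR R).
Proof. by apply: measurable_funD => //; exact: mulrl_measurable. Qed.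

(** [k] times the image of Lebesgue measure under [x |-> k * x + c] gives every interval []a, b]]
    its length, so it is Lebesgue measure by uniqueness. The formula is then integration against an
    image measure. *)
Lemma ge0_integral_affine (f : R -> \bar R) (k c : R) (k0 : 0 < k) :
  measurable_fun [set: R] f -> (forall x, 0 <= f x)%E ->
  (\int[mu]_x f x = k%:E * \int[mu]_x f (k * x + c)%R)%E.
Proof.
move=> mf f0.
pose phi : measurableTypeR R -> measurableTypeR R := fun x => k * x + c.
have mphi : measurable_fun setT phi := measurable_affine k c.
pose nu := mscale (NngNum (ltW k0))
  (measure_function_pushforward__canonical__measure_function_Measure mu mphi).
transitivity (\int[nu]_x f x)%E.
  apply: eq_measure_integral => A mA _; apply: lebesgue_measure_unique => //.
  move=> _ [[a b]] _ <-.
  transitivity (k%:E * mu (phi @^-1` `]a, b]%classic))%E; last by [].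
  rewrite (_ : phi @^-1` _ = `](a - c) / k, (b - c) / k]%classic); last first.
    apply/seteqP; split => x /=; rewrite !in_itv/= ltr_pdivrMr// ler_pdivlMr//;
      rewrite /phi => /andP[? ?]; apply/andP; split; lra.
  rewrite !lebesgue_measure_itv/= !lte_fin ltr_pM2r ?invr_gt0//.
  rewrite ltrD2r; case: ifPn => _; last by rewrite mule0.
  rewrite -!EFinD -EFinM; congr EFin; field.
  exact: lt0r_neq0.
rewrite /nu ge0_integral_mscale//.
rewrite ge0_integral_pushforward//.
Qed.

End affine.

(** * Integrals of powers and exponentials *)

Section power.
Context {R : realType}.
Local Notation mu := (@lebesgue_measure R).

(** Exhaust []0, 1]] by compact intervals away from the singularity. On each, the primitive
    [x^s / s] bounds the integral by [1 / s], and monotone convergence passes to the limit. *)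
Lemma integral_powR_le (s : R) : 0 < s ->
  (\int[mu]_(x in `]0%R, 1%R]) (x `^ (s - 1))%:E <= (s^-1)%:E)%E.
Proof.
move=> s0.
(* The shift to [i.+2] makes the left endpoint strictly less than 1, as the fundamental theorem of
   calculus requires. *)
pose F (i : nat) : set R := `[i.+2%:R^-1, 1]%classic.
have FE : \bigcup_i F i = `]0, 1]%classic.
  apply/seteqP; split => [x [i _]|x]; rewrite /F /= !in_itv/=.
    by move=> /andP[ix ->]; rewrite andbT (lt_le_trans _ ix).
  move=> /andP[x0 x1]; exists (Num.truncn x^-1) => //; rewrite /F /= in_itv/= x1 andbT.
  rewrite invf_ple ?posrE//.
  rewrite (le_trans (ltW (truncnS_gt _)))// ler_nat//.
rewrite -FE.
have cvgF : (\int[mu]_(x in F i) (x `^ (s - 1))%:E)%E @[i --> \oo] -->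
    (\int[mu]_(x in \bigcup_i F i) (x `^ (s - 1))%:E)%E.
  apply: ge0_nondecreasing_set_cvg_integral.
  - move=> i j ij; rewrite subsetEset => x; rewrite /F /= !in_itv/= => /andP[ix ->].
    by rewrite andbT (le_trans _ ix)// lef_pV2 ?posrE// ler_nat !ltnS.
  - by move=> i; exact: measurable_itv.
  - move=> i; apply/measurable_EFinP; apply: measurable_funTS.
    exact: measurable_powR.
  - by move=> i x _; rewrite lee_fin powR_ge0.
rewrite -(cvg_lim _ cvgF)//.
apply: lime_le; first by apply/cvg_ex; eexists; exact: cvgF.
apply: nearW => i.
have i1 : (i.+2%:R^-1 < 1 :> R) by rewrite invf_lt1// ltr1n.
have i0 : (0 < i.+2%:R^-1 :> R) by rewrite invr_gt0.
have der (x : R) : 0 < x -> is_derive x 1 (fun x => x `^ s / s) (x `^ (s - 1)).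
  move=> x0; have d := is_derive1_powR s x0.
  have -> : (fun x : R => x `^ s / s) = s^-1 *: (fun y : R => y `^ s).
    by apply/funext => y /=; rewrite mulrC.
  have -> : x `^ (s - 1) = s^-1 *: (s * x `^ (s - 1)).
    by rewrite -[RHS]/(s^-1 * (s * x `^ (s - 1))) mulrA mulVf ?mul1r// gt_eqF.
  exact: is_deriveZ.
have dc (t x : R) : 0 < x -> {for x, continuous (fun y : R => y `^ t)}.
  move=> x0; apply/differentiable_continuous/derivable1_diffP.
  by apply: derivable_powR; rewrite in_itv/= x0.
have dc' (x : R) : 0 < x -> {for x, continuous (fun x => x `^ s / s)}.
  by move=> x0; apply: cvgM; [exact: dc|exact: cvg_cst].
rewrite (@continuous_FTC2 _ _ (fun x => x `^ s / s))//.
- rewrite powR1 div1r -EFinB lee_fin gerBl divr_ge0 ?powR_ge0//.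
  exact: ltW.
- apply: continuous_in_subspaceT => x; rewrite inE/= in_itv/= => /andP[ix _].
  by apply: dc; exact: lt_le_trans ix.
- split.
  + move=> x; rewrite in_itv/= => /andP[ix _].
    by have [] := der x (lt_trans i0 ix).
  + apply: cvg_at_right_filter; exact: dc'.
  + by apply: cvg_at_left_filter; exact: dc'.
- move=> x; rewrite in_itv/= => /andP[ix _].
  by rewrite derive1E; have [] := der x (lt_trans i0 ix).
Qed.

(** The integrand is twice the density of the exponential law of rate 1/2, whose total mass is 1. *)
Lemma integral_expR_half_fin :
  (\int[mu]_(x in `[0%R, +oo[) (expR (- (2^-1 * x)))%:E < +oo)%E.
Proof.
have h0 : (0 < 2^-1 :> R) by rewrite invr_gt0.
have := integral_exponential_pdf h0.
rewrite /exponential_pdf => h.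
have : (2%:E * \int[mu]_x (exponential_pdf 2^-1 x)%:E < +oo)%E.
  by rewrite h mule1 ltry.
apply: le_lt_trans; rewrite integral_mkcond -ge0_integralZl//=; last 2 first.
- by apply/measurable_EFinP; exact: measurable_exponential_pdf.
- by move=> x _; rewrite lee_fin exponential_pdf_ge0// ltW.
apply: ge0_le_integral => //.
- by move=> x _; apply: erestrict_ge0 => y _; rewrite lee_fin expR_ge0.
- apply: (measurable_restrictT _ _).1 => //; apply/measurable_EFinP.
  apply: measurable_funTS; apply: measurableT_comp => //.
  apply: measurableT_comp => //; exact: mulrl_measurable.
- apply: emeasurable_funM => //; apply/measurable_EFinP; exact: measurable_exponential_pdf.
- move=> x _; rewrite /exponential_pdf !patchE; case: ifPn => _; last by rewrite mule0.
  by rewrite -EFinM mulrA divff// mul1r mulNr.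
Qed.

(** Write [ln x = ln (2m) + ln (x / (2m))] and use [ln y <= y]: the second term, multiplied by [m],
    is at most [x / 2]. *)
Lemma powR_le_expR (m x : R) : 0 < m -> 0 < x ->
  x `^ m <= expR (m * ln (2 * m)) * expR (2^-1 * x).
Proof.
move=> m0 x0; rewrite /powR gt_eqF// -expRD ler_expR.
have x2m : 0 < x / (2 * m) by rewrite divr_gt0// mulr_gt0.
have -> : ln x = ln (2 * m) + ln (x / (2 * m)).
  by rewrite -lnM ?posrE ?mulr_gt0 ?invr_gt0 ?mulr_gt0//; congr (ln _); field; rewrite gt_eqF.
rewrite mulrDr lerD2l (_ : 2^-1 * x = m * (x / (2 * m))); last first.
  by field; rewrite gt_eqF.
by rewrite ler_pM2l// ltW// ln_sublinear.
Qed.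
End power.

(** * The Gamma function, the Beta function and their relation *)

Section gamma.
Context {R : realType}.
Local Notation mu := (@lebesgue_measure R).
Implicit Types a b c s t x : R.

(* [powR] sends negative bases to 1, hence the explicit truncation. *)
Definition tpow s x : R := if 0 < x then x `^ (s - 1) else 0.

Lemma tpow_ge0 s x : 0 <= tpow s x.
Proof. by rewrite /tpow; case: ifP => // _; exact: powR_ge0. Qed.

Lemma tpowE s x : 0 < x -> tpow s x = x `^ (s - 1).
Proof. by rewrite /tpow => ->. Qed.

Lemma tpow0 s x : x <= 0 -> tpow s x = 0.
Proof. by rewrite /tpow ltNge => ->. Qed.

Lemma tpow_scale s c x : 0 < c -> tpow s (c * x) = c `^ (s - 1) * tpow s x.
Proof.
move=> c0; rewrite /tpow pmulr_rgt0//; case: ifPn => [x0|_]; last by rewrite mulr0.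
by rewrite powRM ?ltW.
Qed.

Lemma measurable_tpow s : measurable_fun [set: R] (tpow s).
Proof.
apply: measurable_fun_ifT.
- exact: measurable_fun_ltr.
- exact: (measurableT_comp (measurable_powR (s - 1))).
- exact: measurable_cst.
Qed.

(** Extended-real valued and over the whole line, so that Tonelli and changes of variables apply
    before finiteness is known. *)
Definition eGamma s : \bar R := (\int[mu]_x (tpow s x * expR (- x))%:E)%E.

Lemma measurable_tpow_expR s : measurable_fun [set: R] (fun x => tpow s x * expR (- x)).
Proof.
apply: measurable_funM; first exact: measurable_tpow.
by apply: measurableT_comp => //; exact: measurable_oppr.
Qed.

Lemma GammaE s : Gamma s = fine (eGamma s).
Proof.
rewrite /Gamma /Rintegral /eGamma; congr fine.
rewrite integral_mkcond; apply: eq_integral => x _.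
rewrite patchE /tpow; have [x0|x0] := ltP 0 x.
  by rewrite mem_set//= in_itv/= x0.
by rewrite memNset ?mul0r//= in_itv/= andbT ltNge x0.
Qed.

Lemma eGamma_ge0 s : (0 <= eGamma s)%E.
Proof.
by apply: integral_ge0 => x _; rewrite lee_fin mulr_ge0 ?tpow_ge0 ?expR_ge0.
Qed.

(** The integrand is dominated by [x^(s-1)] on []0, 1]] and by a multiple of [exp(-x/2)] beyond
    1. *)
Lemma eGamma_lty s : 0 < s -> (eGamma s < +oo)%E.
Proof.
move=> s0.
set C := expR (s * ln (2 * s)).
pose f1 x : R := ((fun x => x `^ (s - 1)) \_ `]0, 1]) x.
pose f2 x : R := ((fun x => C * expR (- (2^-1 * x))) \_ `[0, +oo[) x.
have mf1 : measurable_fun setT f1.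
  by apply: (measurable_restrictT _ _).1 => //; apply: measurable_funTS;
    exact: measurable_powR.
have mf2 : measurable_fun setT f2.
  apply: (measurable_restrictT _ _).1 => //; apply: measurable_funTS.
  apply: measurable_funM => //; apply: measurableT_comp => //.
  by apply: measurableT_comp => //; exact: mulrl_measurable.
have f10 x : 0 <= f1 x by rewrite /f1 patchE; case: ifP => // _; exact: powR_ge0.
have f20 x : 0 <= f2 x.
  by rewrite /f2 patchE; case: ifP => // _; rewrite mulr_ge0 ?expR_ge0.
have H : (\int[mu]_x (f1 x)%:E + \int[mu]_x (f2 x)%:E < +oo)%E.
  apply: lte_add_pinfty.
    apply: le_lt_trans (ltry s^-1); apply: le_trans (integral_powR_le s0).
    by rewrite [leRHS]integral_mkcond restrict_EFin.
  have -> : (\int[mu]_x (f2 x)%:E =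
      \int[mu]_(x in `[0%R, +oo[) (C%:E * (expR (- (2^-1 * x)))%:E))%E.
    by rewrite [RHS]integral_mkcond restrict_EFin.
  rewrite ge0_integralZl//=.
  - by rewrite lte_mul_pinfty ?lee_fin ?expR_ge0// integral_expR_half_fin.
  - apply/measurable_EFinP; apply: measurable_funTS.
    apply: measurableT_comp => //.
    by apply: measurableT_comp => //; exact: mulrl_measurable.
  - by rewrite lee_fin expR_ge0.
apply: le_lt_trans H; rewrite -ge0_integralD//; last 4 first.
- by move=> x _; rewrite lee_fin.
- exact/measurable_EFinP.
- by move=> x _; rewrite lee_fin.
- exact/measurable_EFinP.
apply: ge0_le_integral => //.
- by move=> x _; rewrite lee_fin mulr_ge0 ?tpow_ge0 ?expR_ge0.
- by apply/measurable_EFinP; exact: measurable_tpow_expR.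
- by apply/measurable_EFinP/measurable_funD.
move=> x _; rewrite lee_fin; have [x0|x0] := leP x 0.
  by rewrite tpow0// mul0r addr_ge0.
rewrite tpowE//; have [x1|x1] := leP x 1.
  rewrite {1}/f1 patchE mem_set/= ?in_itv/= ?x0//.
  rewrite -[leLHS]addr0 lerD// ger_pMr ?powR_gt0//.
  by rewrite -expR0 ler_expR oppr_le0 ltW.
rewrite -[leLHS]add0r lerD// /f2 patchE mem_set/= ?in_itv/= ?andbT ?(ltW x0)//.
(* For [x > 1], [x^(s-1) <= x^s <= C exp(x/2)]; the exponent is raised to [s] because [powR_le_expR]
   needs a positive one. *)
rewrite (_ : - (2^-1 * x) = 2^-1 * x - x); last by field.
rewrite expRD mulrA ler_wpM2r ?expR_ge0// (le_trans _ (powR_le_expR s0 x0))//.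
by rewrite ler_powR ?(ltW x1)// gerBl.
Qed.

(** A zero integral would make the nonnegative integrand vanish almost everywhere, yet it is
    positive on []0, 1]], which has measure 1. *)
Lemma eGamma_gt0 s : (0 < eGamma s)%E.
Proof.
rewrite lt0e eGamma_ge0 andbT; apply/eqP => e0.
have [N [mN N0 sub]] : (fun x => (tpow s x * expR (- x))%:E) = cst 0%E %[ae mu in setT].
  apply/(ae_eq_integral_abs mu measurableT).
    by apply/measurable_EFinP; exact: measurable_tpow_expR.
  rewrite -[RHS]e0; apply: eq_integral => x _.
  by rewrite gee0_abs// lee_fin mulr_ge0 ?tpow_ge0 ?expR_ge0.
have : (mu `]0%R, 1%R] <= mu N)%E.
  apply: le_measure; rewrite ?inE//.
  move=> x; rewrite /= in_itv/= => /andP[x0 _]; apply: sub => /= /(_ I) /eqP.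
  by rewrite eqe mulf_eq0 (gt_eqF (expR_gt0 _)) orbF tpowE// gt_eqF ?powR_gt0.
by rewrite N0 lebesgue_measure_itv/= lte01 oppr0 adde0 leNgt lte01.
Qed.

Lemma eGamma_fin s : 0 < s -> eGamma s = (Gamma s)%:E.
Proof.
move=> s0; rewrite GammaE fineK// ge0_fin_numE ?eGamma_ge0//; exact: eGamma_lty.
Qed.

Lemma Gamma_gt0 s : 0 < s -> 0 < Gamma s.
Proof. by move=> s0; rewrite -lte_fin -eGamma_fin// eGamma_gt0. Qed.

Definition eBeta a b : \bar R := (\int[mu]_x (tpow a x * tpow b (1 - x))%:E)%E.

Lemma measurable_tpow_conv a b t :
  measurable_fun [set: R] (fun x => tpow a x * tpow b (t - x)).
Proof.
apply: measurable_funM; first exact: measurable_tpow.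
by apply: measurableT_comp; [exact: measurable_tpow|exact: measurable_funB].
Qed.

Lemma tpow_conv_ge0 a b t x : 0 <= tpow a x * tpow b (t - x).
Proof. by rewrite mulr_ge0 ?tpow_ge0. Qed.

(** For [t > 0], substitute [x = t y] and collect the powers of [t]. For [t <= 0] the two truncated
    powers have disjoint supports. *)
Lemma tpow_conv a b t :
  (\int[mu]_x (tpow a x * tpow b (t - x))%:E = (tpow (a + b) t)%:E * eBeta a b)%E.
Proof.
have [t0|t0] := leP t 0.
  rewrite tpow0// mul0e integral0_eq// => x _; have [x0|x0] := leP x 0.
    by rewrite tpow0// mul0r.
  by rewrite (@tpow0 b) ?mulr0// subr_le0 (le_trans t0)// ltW.
rewrite (ge0_integral_affine 0 t0); last 2 first.
- by apply/measurable_EFinP; exact: measurable_tpow_conv.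
- by move=> x; rewrite lee_fin tpow_conv_ge0.
have m0 := measurable_tpow_conv a b t.
have mt : measurable_fun [set: R]
    (fun x => tpow a (t * x + 0) * tpow b (t - (t * x + 0))).
  exact: (measurableT_comp m0 (measurable_affine t 0)).
rewrite -(ge0_integralZl_EFin mu measurableT _ _ (ltW t0)); last 2 first.
- by move=> x _; rewrite lee_fin tpow_conv_ge0.
- exact/measurable_EFinP.
rewrite -(ge0_integralZl_EFin mu measurableT _ _ (tpow_ge0 (a + b) t)); last 2 first.
- by move=> x _; rewrite lee_fin tpow_conv_ge0.
- by apply/measurable_EFinP; exact: measurable_tpow_conv.
apply: eq_integral => x _; rewrite -!EFinM addr0 -[X in X - t * x]mulr1 -mulrBr.
rewrite !tpow_scale// (tpowE (a + b) t0); congr EFin.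
rewrite (_ : a + b - 1 = 1 + (a - 1) + (b - 1)); last by ring.
rewrite !powRD ?(gt_eqF t0) ?implybT// powRr1 ?(ltW t0)//; ring.
Qed.

(** Tonelli for [x^(a-1) (t-x)^(b-1) exp(-t)]: integrating in [t] first, with the shift [t = y + x],
    separates the two Gamma integrals; integrating in [x] first produces the Beta integral. *)
Lemma eGammaM a b : (eGamma a * eGamma b = eGamma (a + b) * eBeta a b)%E.
Proof.
pose f (z : R * R) : \bar R := (tpow a z.1 * tpow b (z.2 - z.1) * expR (- z.2))%:E.
have mf : measurable_fun [set: R * R] f.
  apply/measurable_EFinP; apply: measurable_funM.
    apply: measurable_funM; apply: measurableT_comp => //.
    - exact: measurable_tpow.
    - exact: measurable_tpow.
    - exact: measurable_funB.
  by do 2 apply: measurableT_comp => //.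
have f0 z : (0 <= f z)%E by rewrite lee_fin mulr_ge0 ?expR_ge0 ?tpow_conv_ge0.
transitivity (\int[mu]_x \int[mu]_t f (x, t))%E.
  rewrite muleC -ge0_integralZl//=; last 3 first.
  - by apply/measurable_EFinP; exact: measurable_tpow_expR.
  - by move=> x _; rewrite lee_fin mulr_ge0 ?tpow_ge0 ?expR_ge0.
  - exact: eGamma_ge0.
  apply: eq_integral => x _.
  rewrite [RHS](ge0_integral_affine x ltr01)//; last first.
    by apply: (measurableT_comp mf); exact: pair1_measurable.
  rewrite mul1e muleC -ge0_integralZl//=; last 3 first.
  - by apply/measurable_EFinP; exact: measurable_tpow_expR.
  - by move=> y _; rewrite lee_fin mulr_ge0 ?tpow_ge0 ?expR_ge0.
  - by rewrite lee_fin mulr_ge0 ?tpow_ge0 ?expR_ge0.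
  apply: eq_integral => y _; rewrite /f /= -EFinM mul1r addrK opprD expRD.
  congr EFin; ring.
rewrite fubini_tonelli// muleC -ge0_integralZl//=; last 3 first.
- by apply/measurable_EFinP; exact: measurable_tpow_expR.
- by move=> x _; rewrite lee_fin mulr_ge0 ?tpow_ge0 ?expR_ge0.
- by apply: integral_ge0 => x _; rewrite lee_fin tpow_conv_ge0.
apply: eq_integral => t _; rewrite EFinM muleA (muleC (eBeta a b)) -tpow_conv muleC.
rewrite -ge0_integralZl//=; last 2 first.
- by apply/measurable_EFinP; exact: measurable_tpow_conv.
- by move=> x _; rewrite lee_fin tpow_conv_ge0.
by apply: eq_integral => x _; rewrite /f -EFinM /= mulrC.
Qed.

Lemma eBetaE a b : 0 < a -> 0 < b ->
  eBeta a b = (Gamma a * Gamma b / Gamma (a + b))%:E.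
Proof.
move=> a0 b0; have ab0 : 0 < a + b by exact: addr_gt0.
have G0 := Gamma_gt0 ab0.
have := eGammaM a b; rewrite !eGamma_fin// => /esym.
move=> /(congr1 (fun x : \bar R => (Gamma (a + b))^-1%:E * x)%E).
rewrite muleA -EFinM (mulVf (lt0r_neq0 G0)) mul1e => ->.
by rewrite -!EFinM mulrC.
Qed.

End gamma.

(** * Gaussian integrals over R^n *)

Section gaussian.
Context {R : realType}.
Local Notation mu := (@lebesgue_measure R).

(** Tonelli by induction on the dimension, splitting off the first coordinate. *)
Lemma ge0_integral_rV_prod n (h : 'I_n -> R -> R) :
  (forall i, measurable_fun [set: R] (h i)) -> (forall i x, 0 <= h i x) ->
  (\int[lebesgue_rV R n]_x (\prod_(i < n) h i (x ord0 i))%:E =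
   \prod_(i < n) \int[mu]_y (h i y)%:E)%E.
Proof.
elim: n h => [|n IH] h mh h0.
  rewrite big_ord0 /=.
  under eq_integral do rewrite big_ord0.
  by rewrite integral_cst//= mul1e diracT.
have mprod k (g : 'I_k -> R -> R) : (forall i, measurable_fun [set: R] (g i)) ->
    measurable_fun [set: 'rV[R]_k] (fun x => (\prod_(i < k) g i (x ord0 i))%:E).
  move=> mg; apply/measurable_EFinP; apply: measurable_prod => i _.
  exact: (measurableT_comp (mg i) (measurable_coord i)).
(* In dimension [n.+1] Lebesgue measure is by definition this pushforward of a product measure. *)
rewrite [LHS](_ : _ =
  \int[pushforward (mu \x lebesgue_rV R n) (@rV_cons R n : measurableTypeR R * _ -> _)]_x
    (\prod_(i < n.+1) h i (x ord0 i))%:E)%E //.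
rewrite ge0_integral_pushforward//; last 3 first.
- exact: measurable_rV_cons.
- exact: mprod.
- by move=> x _; rewrite lee_fin prodr_ge0.
rewrite preimage_setT fubini_tonelli1//=; last 2 first.
- exact: (measurableT_comp (mprod _ _ mh) (@measurable_rV_cons R n)).
- by move=> x; rewrite lee_fin prodr_ge0.
rewrite big_ord_recl muleC -ge0_integralZl//=; last 3 first.
- by apply/measurable_EFinP; exact: mh.
- by move=> x _; rewrite lee_fin.
- by apply: prode_ge0 => i _; apply: integral_ge0 => x _; rewrite lee_fin.
apply: eq_integral => t _; rewrite /fubini_F muleC -IH//.
rewrite -ge0_integralZl//=.
- apply: eq_integral => x _; rewrite -EFinM big_ord_recl rV_cons0.
  by congr (_ * _)%:E; apply: eq_bigr => i _; rewrite rV_cons_lift.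
- exact: (mprod _ (fun i => h (lift ord0 i))).
- by move=> x _; rewrite lee_fin prodr_ge0.
- by rewrite lee_fin.
Qed.

(** The integrand is a multiple of the normal density of mean [m] and variance [v]. *)
Lemma integral_gauss (m v : R) : 0 < v ->
  (\int[mu]_y (expR (- ((y - m) ^+ 2 / (2 * v))))%:E =
   (Num.sqrt (2 * pi * v))%:E)%E.
Proof.
move=> v0.
have sv0 : Num.sqrt v != 0 by rewrite gt_eqF// sqrtr_gt0.
have pv0 : 0 < 2 * pi * v by rewrite !mulr_gt0// pi_gt0.
transitivity (\int[mu]_y ((Num.sqrt (2 * pi * v))%:E *
    (normal_pdf m (Num.sqrt v) y)%:E))%E.
  apply: eq_integral => y _; rewrite normal_pdfE// -EFinM; congr EFin.
  rewrite /normal_peak /normal_fun sqr_sqrtr ?ltW// mulrA.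
  rewrite (_ : v * pi *+ 2 = 2 * pi * v); last by ring.
  rewrite divff ?gt_eqF ?sqrtr_gt0// mul1r; congr expR.
  by rewrite -mulNr; congr (_ / _); ring.
rewrite ge0_integralZl//=; last 2 first.
- by apply/measurable_EFinP; exact: measurable_normal_pdf.
- by move=> y _; rewrite lee_fin normal_pdf_ge0.
by rewrite integral_normal_pdf mule1.
Qed.

Lemma sqnorm_ge0 n (x : 'rV[R]_n) : 0 <= sqnorm x.
Proof. by apply: sumr_ge0 => i _; exact: sqr_ge0. Qed.

Lemma measurable_sqnorm n : measurable_fun [set: 'rV[R]_n] (@sqnorm R n).
Proof.
apply: measurable_sum => i; apply: measurable_funX.
exact: measurable_coord.
Qed.

Lemma expR_sqnorm n (c : R) (x : 'rV[R]_n) :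
  expR (- (c * sqnorm x)) = \prod_(i < n) expR (- (c * x ord0 i ^+ 2)).
Proof. by rewrite -expR_sum sumrN mulr_sumr. Qed.

Lemma integral_rV_gauss_lty n (c : R) : 0 < c ->
  (\int[lebesgue_rV R n]_x (expR (- (c * sqnorm x)))%:E < +oo)%E.
Proof.
move=> c0; under eq_integral do rewrite expR_sqnorm.
rewrite (ge0_integral_rV_prod (h := fun _ y => expR (- (c * y ^+ 2))))//; last first.
  move=> _; apply: measurableT_comp => //; apply: measurableT_comp => //.
  by apply: measurable_funM => //; exact: measurable_funX.
have -> : (\int[mu]_y (expR (- (c * y ^+ 2)))%:E)%E =
    (Num.sqrt (2 * pi * (2 * c)^-1))%:E.
  have c2 : 0 < (2 * c)^-1 by rewrite invr_gt0 mulr_gt0.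
  rewrite -(integral_gauss 0 c2).
  apply: eq_integral => y _; rewrite subr0; congr (expR (- _))%:E.
  by field; rewrite gt_eqF.
by rewrite prodEFin ltry.
Qed.

(** Complete the square: with [d = 1 + 4cs], [(x-y)^2/(4s) + c y^2 = (y - x/d)^2 d/(4s) + c x^2/d].
    In [y] this is a Gaussian of mean [x/d] and variance [v = 2s/d]. *)
Lemma integral_heat1_gauss (x s c : R) : 0 < s -> 0 < c ->
  (\int[mu]_y ((Num.sqrt (4 * pi * s))^-1 *
      expR (- ((x - y) ^+ 2 / (4 * s))) * expR (- (c * y ^+ 2)))%:E =
   ((Num.sqrt (1 + 4 * c * s))^-1 *
      expR (- (c * x ^+ 2 / (1 + 4 * c * s))))%:E)%E.
Proof.
move=> s0 c0.
have d0 : 0 < 1 + 4 * c * s by rewrite addr_gt0// !mulr_gt0.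
have ps0 : 0 < 4 * pi * s by rewrite !mulr_gt0// pi_gt0.
set d := 1 + 4 * c * s in d0 *.
pose v := 2 * s / d.
have v0 : 0 < v by rewrite divr_gt0// mulr_gt0.
transitivity (\int[mu]_y
   (((Num.sqrt (4 * pi * s))^-1 * expR (- (c * x ^+ 2 / d)))%:E *
    (expR (- ((y - x / d) ^+ 2 / (2 * v))))%:E))%E.
  apply: eq_integral => y _; rewrite -EFinM -!mulrA; congr (_ * _)%:E.
  rewrite -!expRD; congr expR; rewrite /v.
  (* Eliminating [c] in favour of [d] leaves a rational identity in [x], [y], [s] and [d]. *)
  have -> : c = (d - 1) / (4 * s) by rewrite /d; field; rewrite gt_eqF.
  by field; rewrite !gt_eqF.
rewrite ge0_integralZl//=; last first.
  apply/measurable_EFinP; apply: measurableT_comp => //; apply: measurableT_comp => //.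
  apply: measurable_funM => //; apply: measurable_funX.
  exact: measurable_funB.
rewrite integral_gauss// -EFinM mulrAC; congr (_ * _)%:E.
rewrite (_ : 2 * pi * v = 4 * pi * s * d^-1); last by rewrite /v; ring.
by rewrite (sqrtrM _ (ltW ps0)) mulrA mulVf ?gt_eqF ?sqrtr_gt0// mul1r sqrtrV// ltW.
Qed.

(** Kernel, Gaussian and normalizing constant all factor over the coordinates, which reduces this to
    dimension 1. *)
Lemma integral_heat_gauss n (x : 'rV[R]_n) (s c : R) : 0 < s -> 0 < c ->
  (\int[lebesgue_rV R n]_y (((4 * pi * s) `^ (n%:R / 2))^-1 *
      expR (- (sqnorm (x - y) / (4 * s))) * expR (- (c * sqnorm y)))%:E =
   ((Num.sqrt (1 + 4 * c * s))^-1 ^+ n *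
      expR (- (c * sqnorm x / (1 + 4 * c * s))))%:E)%E.
Proof.
move=> s0 c0.
have ps0 : 0 < 4 * pi * s by rewrite !mulr_gt0// pi_gt0.
have -> : (4 * pi * s) `^ (n%:R / 2) = Num.sqrt (4 * pi * s) ^+ n.
  by rewrite (mulrC n%:R) powRrM powR12_sqrt ?ltW// powR_mulrn.
pose h (i : 'I_n) y := (Num.sqrt (4 * pi * s))^-1 *
      expR (- ((x ord0 i - y) ^+ 2 / (4 * s))) * expR (- (c * y ^+ 2)).
have hE y : (Num.sqrt (4 * pi * s) ^+ n)^-1 *
      expR (- (sqnorm (x - y) / (4 * s))) * expR (- (c * sqnorm y)) =
    \prod_(i < n) h i (y ord0 i).
  rewrite /h big_split big_split prodr_const card_ord exprVn.
  rewrite (expR_sqnorm c y); congr (_ * _ * _).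
  rewrite (mulrC (sqnorm _)) expR_sqnorm.
  by apply: eq_bigr => i _; rewrite !mxE (mulrC (4 * s)^-1).
under eq_integral do rewrite hE.
rewrite ge0_integral_rV_prod; last 2 first.
- move=> i; apply: measurable_funM.
    apply: measurable_funM => //; apply: measurableT_comp => //.
    apply: measurableT_comp => //; apply: measurable_funM => //.
    by apply: measurable_funX; exact: measurable_funB.
  apply: measurableT_comp => //; apply: measurableT_comp => //.
  by apply: measurable_funM => //; exact: measurable_funX.
- by move=> i y; rewrite !mulr_ge0 ?expR_ge0// invr_ge0 sqrtr_ge0.
under eq_bigr do rewrite integral_heat1_gauss//.
rewrite prodEFin big_split/= prodr_const card_ord; congr (_ * _)%:E.
rewrite [in RHS]mulrAC expR_sqnorm.
by apply: eq_bigr => i _; rewrite mulrAC.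
Qed.

End gaussian.

(** * The fractional integral of a damped power *)

Section source.
Context {R : realType} {n : nat}.
Local Notation mu := (@lebesgue_measure R).
Implicit Types (a b c k s t tau : R) (x y : 'rV[R]_n) (z w : 'rV[R]_n * R).

(** The decay rate [2nc] in time makes this Gaussian a subsolution of the heat equation. *)
Definition gauss_damp c z : R := expR (- (c * (sqnorm z.1 + 2 * n%:R * z.2))).

(** As [tpow b] is [t^(b-1)] for [t > 0], a source growing like [t^gamma] has [b = gamma + 1]. *)
Definition source k b c z : R := k * tpow b z.2 * gauss_damp c z.

(* [(4 pi s)^(-n/2) exp(-|.|^2/(4s))] convolved with [exp(-c|.|^2)] at [x],
   times [exp(-2nc tau)]. *)
Definition damped_conv c x s tau : R :=
  let r := (Num.sqrt (1 + 4 * c * s))^-1 in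
  expR (- (c * (2 * n%:R * tau))) * (r ^+ n * expR (- (c * sqnorm x * r ^+ 2))).

Lemma measurable_gauss_damp c : measurable_fun [set: 'rV[R]_n * R] (gauss_damp c).
Proof.
apply: measurableT_comp => //; apply: measurableT_comp => //.
apply: measurable_funM => //; apply: measurable_funD.
  by apply: measurableT_comp => //; exact: measurable_sqnorm.
by apply: measurable_funM => //; exact: measurable_snd.
Qed.

Lemma measurable_source k b c : measurable_fun [set: 'rV[R]_n * R] (source k b c).
Proof.
apply: measurable_funM; last exact: measurable_gauss_damp.
apply: measurable_funM => //; apply: measurableT_comp => //.
exact: measurable_tpow.
Qed.

Lemma source_ge0 k b c z : 0 <= k -> 0 <= source k b c z.
Proof. by move=> k0; rewrite !mulr_ge0 ?tpow_ge0 ?expR_ge0. Qed.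

Lemma damped_conv_ge0 c x s tau : 0 <= damped_conv c x s tau.
Proof. by rewrite !mulr_ge0 ?expR_ge0// exprn_ge0// invr_ge0 sqrtr_ge0. Qed.

(** Each factor is at most 1. This bound makes the fractional integral finite and gives the
    domination used for its continuity. *)
Lemma damped_conv_le1 c x s tau : 0 <= c -> 0 <= s -> 0 <= tau ->
  damped_conv c x s tau <= 1.
Proof.
move=> c0 s0 t0.
have d1 : 1 <= 1 + 4 * c * s by rewrite lerDl !mulr_ge0.
have q1 : 1 <= Num.sqrt (1 + 4 * c * s).
  by have := ler_wsqrtr d1; rewrite sqrtr1.
rewrite /damped_conv !mulr_ile1 ?expR_ge0 ?mulr_ge0 ?expR_ge0 ?exprn_ge0 ?invr_ge0 ?sqrtr_ge0//.
- by rewrite expR_le1 oppr_le0 !mulr_ge0.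
- apply: exprn_ile1; rewrite ?invr_ge0 ?sqrtr_ge0//.
  by rewrite invf_le1 ?(lt_le_trans ltr01 q1).
- by rewrite expR_le1 oppr_le0 !mulr_ge0 ?sqnorm_ge0// exprn_ge0// invr_ge0 sqrtr_ge0.
Qed.

(** Since [1 + 4cs <= exp(4cs)], each factor [(1 + 4cs)^(-1/2)] is at least [exp(-2cs)], and the [n]
    of them supply the time decay over [s]. In the spatial exponent, division by [1 + 4cs >= 1] only
    helps. *)
Lemma damped_conv_ge c x s tau : 0 <= c -> 0 <= s ->
  gauss_damp c (x, s + tau) <= damped_conv c x s tau.
Proof.
move=> c0 s0.
have cs0 : 0 <= 4 * c * s by rewrite !mulr_ge0.
have d0 : 0 < 1 + 4 * c * s by rewrite ltr_pwDl.
rewrite /gauss_damp /damped_conv /=.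
have -> : - (c * (sqnorm x + 2 * n%:R * (s + tau))) =
    - (c * (2 * n%:R * tau)) + (n%:R * - (2 * c * s) + - (c * sqnorm x)) by ring.
rewrite !expRD ler_wpM2l ?expR_ge0// ler_pM ?expR_ge0//.
  rewrite expRM_natl lerXn2r ?nnegrE ?expR_ge0 ?invr_ge0 ?sqrtr_ge0//.
  rewrite expRN lef_pV2 ?posrE ?expR_gt0 ?sqrtr_gt0//.
  rewrite -[leRHS]ger0_norm ?expR_ge0// -sqrtr_sqr ler_sqrt ?exprn_gt0 ?expR_gt0//.
  rewrite -expRM_natl (_ : 4 * c * s = 2 * (2 * c * s)); last by ring.
  exact: expR_ge1Dx.
rewrite ler_expR lerN2 exprVn sqr_sqrtr ?(ltW d0)// ler_pdivrMr// ler_peMr//.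
  by rewrite mulr_ge0 ?sqnorm_ge0.
by rewrite lerDl.
Qed.

(* Powers [`^ (- r)] rather than inverses, because [powR^~ r] is measurable on
   the whole line. *)
Definition J_integrand alpha k b c z w : R :=
  k / Gamma alpha * tpow b w.2 * tpow alpha (z.2 - w.2) *
  expR (- (c * (2 * n%:R * w.2))) *
  ((4 * pi * (z.2 - w.2)) `^ (- (n%:R / 2)) *
   expR (- (sqnorm (z.1 - w.1) * (4 * (z.2 - w.2)) `^ (-1))) *
   expR (- (c * sqnorm w.1))).

Lemma measurable_J_integrand alpha k b c z :
  measurable_fun [set: 'rV[R]_n * R] (J_integrand alpha k b c z).
Proof.
have ms : measurable_fun [set: 'rV[R]_n * R] (fun w => z.2 - w.2).
  by apply: measurable_funB => //; exact: measurable_snd.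
apply: measurable_funM; last apply: measurable_funM; last first.
- apply: measurableT_comp => //; apply: measurableT_comp => //.
  apply: measurable_funM => //.
  by apply: measurableT_comp => //; exact: measurable_sqnorm.
- apply: measurable_funM.
    apply: (measurableT_comp (measurable_powR _)).
    by apply: measurable_funM.
  apply: measurableT_comp => //; apply: measurableT_comp => //.
  apply: measurable_funM.
    apply: (measurableT_comp (@measurable_sqnorm R n)).
    apply/measurable_fun_coordP => i.
    under eq_fun do rewrite !mxE.
    apply: measurable_funB => //.
    by apply: (measurableT_comp (measurable_coord i)); exact: measurable_fst.
  apply: (measurableT_comp (measurable_powR _)).
  by apply: measurable_funM.
- apply: measurable_funM.
    apply: measurable_funM.
      apply: measurable_funM => //.
      by apply: (measurableT_comp (measurable_tpow b)); exact: measurable_snd.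
    exact: (measurableT_comp (measurable_tpow alpha)).
  apply: measurableT_comp => //; apply: measurableT_comp => //.
  by apply: measurable_funM => //; apply: measurable_funM => //; exact: measurable_snd.
Qed.

Lemma J_integrand_ge0 alpha k b c z w : 0 < alpha -> 0 <= k ->
  0 <= J_integrand alpha k b c z w.
Proof.
move=> a0 k0; have G0 := Gamma_gt0 a0.
by rewrite !mulr_ge0 ?tpow_ge0 ?expR_ge0 ?powR_ge0// invr_ge0 ltW.
Qed.

(** By Tonelli the space integral can be done first, where it is the heat flow of a Gaussian, known
    explicitly. *)
Lemma J_sourceE alpha k b c x t : 0 < alpha -> 0 <= k -> 0 < c ->
  (J alpha (source k b c) (x, t) = \int[mu]_tau
    (k / Gamma alpha * (tpow b tau * tpow alpha (t - tau)) *
     damped_conv c x (t - tau) tau)%:E)%E.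
Proof.
move=> a0 k0 c0; rewrite /J integral_mkcond.
(* The restriction to [tau < t] is absorbed by [tpow alpha (t - tau)], which vanishes for
   [tau >= t]. *)
transitivity (\int[lebesgue_spacetime R n]_w
    (J_integrand alpha k b c (x, t) w)%:E)%E.
  apply: eq_integral => -[y tau] _; rewrite patchE /J_integrand /=.
  have [tt|tt] := ltP tau t; last first.
    by rewrite memNset/= ?ltNge ?tt// (@tpow0 _ alpha) ?subr_le0// mulr0 !mul0r.
  have s0 : 0 < t - tau by rewrite subr_gt0.
  rewrite mem_set//= /frac_heat_kernel s0 /source /gauss_damp /= (tpowE _ s0).
  rewrite powRN powR_inv1 ?mulr_ge0 ?ltW//.
  rewrite (mulrDr c (sqnorm y)) (opprD (c * sqnorm y)) expRD; congr EFin; ring.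
rewrite /lebesgue_spacetime fubini_tonelli2; last 2 first.
- by apply/measurable_EFinP; exact: measurable_J_integrand.
- by move=> w; rewrite lee_fin J_integrand_ge0.
apply: eq_integral => tau _; rewrite /fubini_G /J_integrand /=.
have [tt|tt] := leP t tau.
  rewrite (@tpow0 _ alpha) ?subr_le0// !(mulr0, mul0r) integral0_eq//.
  by move=> y _; rewrite !mul0r.
have s0 : 0 < t - tau by rewrite subr_gt0.
transitivity (\int[lebesgue_rV R n]_y
  ((k / Gamma alpha * tpow b tau * tpow alpha (t - tau) *
    expR (- (c * (2 * n%:R * tau))))%:E *
   (((4 * pi * (t - tau)) `^ (n%:R / 2))^-1 *
      expR (- (sqnorm (x - y) / (4 * (t - tau)))) * expR (- (c * sqnorm y)))%:E))%E.
  apply: eq_integral => y _.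
  by rewrite powRN powR_inv1 ?mulr_ge0 ?ltW// -EFinM.
rewrite ge0_integralZl//=.
- rewrite integral_heat_gauss// -EFinM /damped_conv !exprVn sqr_sqrtr.
    congr EFin; ring.
  by rewrite addr_ge0// !mulr_ge0// ltW.
- apply/measurable_EFinP; apply: measurable_funM; last first.
    apply: measurableT_comp => //; apply: measurableT_comp => //.
    by apply: measurable_funM => //; exact: measurable_sqnorm.
  apply: measurable_funM => //; apply: measurableT_comp => //.
  apply: measurableT_comp => //; apply: measurable_funM => //.
  apply: (measurableT_comp (@measurable_sqnorm R n)).
  apply/measurable_fun_coordP => i.
  under eq_fun do rewrite !mxE.
  by apply: measurable_funB => //; exact: measurable_coord.
- by move=> y _; rewrite lee_fin !mulr_ge0 ?expR_ge0// invr_ge0 powR_ge0.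
- by rewrite lee_fin !mulr_ge0 ?tpow_ge0 ?expR_ge0// invr_ge0 ltW// Gamma_gt0.
Qed.

End source.

(** * Scaling form and lower bound of the fractional integral *)

Section J_source.
Context {R : realType} {n : nat}.
Local Notation mu := (@lebesgue_measure R).
Implicit Types (a b c k s t tau : R) (x y : 'rV[R]_n) (z w : 'rV[R]_n * R).

(** The time integrand after [tau = t theta]: the power of [t] has been factored out, and the
    support in [theta] no longer depends on [t]. *)
Definition profile_integrand alpha b c x t theta : R :=
  tpow b theta * tpow alpha (1 - theta) *
  damped_conv c x (t * (1 - theta)) (t * theta).

Definition profile alpha b c x t : \bar R :=
  (\int[mu]_theta (profile_integrand alpha b c x t theta)%:E)%E.

(** Clamping time at 0 keeps the profile in the range where it is finite and continuous; for
    negative times the prefactor [tpow] makes the value 0. *)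
Definition J_source alpha k b c z : R :=
  k / Gamma alpha * tpow (alpha + b) z.2 *
  fine (profile alpha b c z.1 (Num.max z.2 0)).

Lemma J_source_le0 alpha k b c z : z.2 <= 0 -> J_source alpha k b c z = 0.
Proof. by move=> z0; rewrite /J_source tpow0// mulr0 mul0r. Qed.

Lemma profile_integrand_ge0 alpha b c x t theta :
  0 <= profile_integrand alpha b c x t theta.
Proof. by rewrite !mulr_ge0 ?tpow_ge0 ?damped_conv_ge0. Qed.

Lemma measurable_damped_conv c x (f g : R -> R) :
  measurable_fun [set: R] f -> measurable_fun [set: R] g ->
  measurable_fun [set: R] (fun r => damped_conv c x (f r) (g r)).
Proof.
move=> mf mg.
have mr : measurable_fun [set: R] (fun r => (Num.sqrt (1 + 4 * c * f r))^-1).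
  under eq_fun do rewrite -powR_inv1 ?sqrtr_ge0//.
  apply: (measurableT_comp (measurable_powR _)).
  apply: (measurableT_comp (continuous_measurable_fun (@sqrt_continuous R))).
  by apply: measurable_funD => //; exact: measurable_funM.
apply: measurable_funM.
  apply: measurableT_comp => //; apply: measurableT_comp => //.
  by apply: measurable_funM => //; exact: measurable_funM.
apply: measurable_funM; first exact: measurable_funX.
apply: measurableT_comp => //; apply: measurableT_comp => //.
apply: measurable_funM => //.
exact: measurable_funX.
Qed.

Lemma measurable_profile_integrand alpha b c x t :
  measurable_fun [set: R] (profile_integrand alpha b c x t).
Proof.
apply: measurable_funM; first exact: measurable_tpow_conv.
by apply: measurable_damped_conv; apply: measurable_funM => //; exact: measurable_funB.
Qed.

Lemma profile_integrand_le alpha b c x t theta : 0 <= c -> 0 <= t ->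
  profile_integrand alpha b c x t theta <= tpow b theta * tpow alpha (1 - theta).
Proof.
move=> c0 t0; rewrite /profile_integrand.
have [r0|r0] := leP theta 0; first by rewrite tpow0// !mul0r.
have [r1|r1] := leP 1 theta.
  by rewrite (@tpow0 _ alpha) ?subr_le0// mulr0 mul0r.
rewrite ler_piMr ?tpow_conv_ge0// damped_conv_le1//.
  by rewrite mulr_ge0// subr_ge0 ltW.
by rewrite mulr_ge0// ltW.
Qed.

Lemma profile_le alpha b c x t : 0 <= c -> 0 <= t ->
  (profile alpha b c x t <= eBeta b alpha)%E.
Proof.
move=> c0 t0; apply: ge0_le_integral => //.
- by move=> r _; rewrite lee_fin profile_integrand_ge0.
- by apply/measurable_EFinP; exact: measurable_profile_integrand.
- by apply/measurable_EFinP; exact: measurable_tpow_conv.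
by move=> r _; rewrite lee_fin; exact: profile_integrand_le.
Qed.

(** The two times [t (1 - theta)] and [t theta] add up to [t], so the lower bound of
    [damped_conv_ge] does not depend on [theta] and leaves the Beta integral. *)
Lemma profile_ge alpha b c x t : 0 <= c -> 0 <= t ->
  ((gauss_damp c (x, t))%:E * eBeta b alpha <= profile alpha b c x t)%E.
Proof.
move=> c0 t0; rewrite -ge0_integralZl//=.
- apply: ge0_le_integral => //.
  + by move=> r _; rewrite lee_fin mulr_ge0 ?expR_ge0 ?tpow_conv_ge0.
  + apply/measurable_EFinP; apply: measurable_funM => //.
    exact: measurable_tpow_conv.
  + by apply/measurable_EFinP; exact: measurable_profile_integrand.
  move=> r _; rewrite lee_fin /profile_integrand mulrC.
  have [r1|r1] := leP 1 r; first by rewrite (@tpow0 _ alpha) ?subr_le0// mulr0 !mul0r.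
  rewrite ler_wpM2l ?tpow_conv_ge0//.
  (* Split [t] to match [damped_conv_ge]; the next two rewrites restore the arguments of
     [damped_conv]. *)
  have -> : t = t * (1 - r) + t * r by ring.
  have -> : (t * (1 - r) + t * r) * (1 - r) = t * (1 - r) by ring.
  have -> : (t * (1 - r) + t * r) * r = t * r by ring.
  by apply: damped_conv_ge => //; rewrite mulr_ge0// subr_ge0 ltW.
- by apply/measurable_EFinP; exact: measurable_tpow_conv.
- by move=> r _; rewrite lee_fin tpow_conv_ge0.
- by rewrite lee_fin expR_ge0.
Qed.

Lemma profile_fin alpha b c x t : 0 < alpha -> 0 < b -> 0 <= c -> 0 <= t ->
  profile alpha b c x t \is a fin_num.
Proof.
move=> a0 b0 c0 t0; rewrite ge0_fin_numE.
  by apply: le_lt_trans (profile_le _ _ _ c0 t0) _; rewrite eBetaE// ltry.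
by apply: integral_ge0 => r _; rewrite lee_fin profile_integrand_ge0.
Qed.

(** For [t > 0], substitute [tau = t theta] in [J_sourceE]; for [t <= 0] the truncated powers have
    disjoint supports. *)
Lemma J_source_eq alpha k b c z : 0 < alpha -> 0 <= k -> 0 < b -> 0 < c ->
  J alpha (source k b c) z = (J_source alpha k b c z)%:E.
Proof.
case: z => x t a0 k0 b0 c0; rewrite J_sourceE// /J_source /=.
have G0 := Gamma_gt0 a0.
have [t0|t0] := leP t 0.
  rewrite tpow0// mulr0 mul0r integral0_eq// => r _.
  have [r0|r0] := leP r 0; first by rewrite tpow0// mul0r mulr0 mul0r.
  by rewrite (@tpow0 _ alpha) ?mulr0 ?mul0r// subr_le0 (le_trans t0)// ltW.
rewrite EFinM fineK ?profile_fin// ?ltW//.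
pose g r := k / Gamma alpha * (tpow b r * tpow alpha (t - r)) *
  damped_conv c x (t - r) r.
have mG : measurable_fun [set: R] g.
  apply: measurable_funM.
    by apply: measurable_funM => //; exact: measurable_tpow_conv.
  by apply: measurable_damped_conv => //; exact: measurable_funB.
have G_ge0 r : 0 <= g r.
  by rewrite !mulr_ge0 ?tpow_ge0 ?damped_conv_ge0// invr_ge0 ltW.
have gE r : t * g (t * r + 0) = k / Gamma alpha * tpow (alpha + b) t *
    profile_integrand alpha b c x t r.
  rewrite /g addr0 (_ : t - t * r = t * (1 - r)); last by ring.
  rewrite /profile_integrand !tpow_scale// (tpowE _ t0).
  rewrite (_ : alpha + b - 1 = 1 + (alpha - 1) + (b - 1)); last by ring.
  rewrite !powRD ?(gt_eqF t0) ?implybT// powRr1 ?(ltW t0)//; ring.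
transitivity (t%:E * \int[mu]_r (g (t * r + 0))%:E)%E.
  apply: (ge0_integral_affine (f := EFin \o g)) => //.
  exact/measurable_EFinP.
have mG' : measurable_fun [set: R] (fun r => g (t * r + 0)).
  exact: (measurableT_comp mG (measurable_affine t 0)).
have kt0 : 0 <= k / Gamma alpha * tpow (alpha + b) t.
  by rewrite !mulr_ge0 ?tpow_ge0// invr_ge0 ltW.
rewrite -(ge0_integralZl_EFin mu measurableT _ _ (ltW t0)); last 2 first.
- by move=> r _; rewrite lee_fin; exact: G_ge0.
- exact/measurable_EFinP.
rewrite -(ge0_integralZl_EFin mu measurableT _ _ kt0); last 2 first.
- by move=> r _; rewrite lee_fin profile_integrand_ge0.
- by apply/measurable_EFinP; exact: measurable_profile_integrand.
by apply: eq_integral => r _; rewrite -!EFinM gE.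
Qed.

(** Insert the Gamma form of the Beta integral in [profile_ge]; the factor [Gamma alpha] cancels the
    one in the kernel. *)
Lemma J_source_ge alpha k b c z : 0 < alpha -> 0 <= k -> 0 < b -> 0 < c ->
  k * (Gamma b / Gamma (alpha + b)) * tpow (alpha + b) z.2 * gauss_damp c z <=
  J_source alpha k b c z.
Proof.
move=> a0 k0 b0 c0; have G0 := Gamma_gt0 a0.
have [t0|t0] := leP z.2 0.
  by rewrite /J_source tpow0// !(mulr0, mul0r).
have h : gauss_damp c z * (Gamma b * Gamma alpha / Gamma (b + alpha)) <=
    fine (profile alpha b c z.1 z.2).
  rewrite -lee_fin fineK; last by apply: profile_fin => //; exact: ltW.
  rewrite EFinM -eBetaE// [X in gauss_damp _ X]surjective_pairing.
  by apply: profile_ge; exact: ltW.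
rewrite /J_source; have -> : Num.max z.2 0 = z.2 by apply/max_idPl; exact: ltW.
have := ler_wpM2l _ h => /(_ (k / Gamma alpha * tpow (alpha + b) z.2)).
rewrite mulr_ge0 ?tpow_ge0 ?divr_ge0 ?(ltW G0)// => /(_ isT).
apply: le_trans; rewrite le_eqVlt; apply/orP; left; apply/eqP.
rewrite (addrC b).
have ring_id (x y w : R) : y != 0 -> w != 0 ->
    k * (x / w) * tpow (alpha + b) z.2 * gauss_damp c z =
    k / y * tpow (alpha + b) z.2 * (gauss_damp c z * (x * y / w)).
  by move: (tpow _ _) (gauss_damp _ _) => ? ? y0 w0; field; rewrite ?y0 ?w0.
have Gab0 := lt0r_neq0 (Gamma_gt0 (addr_gt0 a0 b0)).
by rewrite (ring_id _ _ _ (lt0r_neq0 G0) Gab0).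
Qed.

End J_source.

(** * Continuity of the fractional integral *)

Lemma cvgn_continuous (U V : topologicalType) (h : U -> V) (v : nat -> U) (l : U) :
  {for l, continuous h} -> v k @[k --> \oo] --> l -> h (v k) @[k --> \oo] --> h l.
Proof. exact: continuous_cvg. Qed.

Section continuity.
Context {R : realType}.
Local Notation mu := (@lebesgue_measure R).

(** Dominated convergence concerns sequences, hence this criterion. If continuity fails at [z],
    choosing a bad point in each ball of radius [1/(k+1)] gives a sequence that contradicts the
    hypothesis. *)
Lemma sequentially_continuous (T : pseudoMetricType R) (f : T -> R) :
  (forall (z : T) (u : nat -> T), u k @[k --> \oo] --> z ->
    f (u k) @[k --> \oo] --> f z) -> continuous f.
Proof.
move=> sf z; apply: contrapT => ncf.
have [e e0 He] : exists2 e : R, 0 < e &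
    forall k : nat, exists y, ball z k.+1%:R^-1 y /\ e <= `|f z - f y|.
  apply: contrapT => H; apply: ncf; apply/cvgrPdist_lt => e e0.
  apply: contrapT => He; apply: H; exists e => // k; apply: contrapT => Hk; apply: He.
  apply/nbhs_ballP; exists k.+1%:R^-1 => /=; first by rewrite invr_gt0.
  move=> y zy /=; rewrite ltNge; apply/negP => ey; apply: Hk.
  by exists y.
have [u Hu] := choice He.
have uz : u k @[k --> \oo] --> z.
  apply/cvg_ballP => d d0; near=> k.
  apply: (@le_ball _ _ _ k.+1%:R^-1); last by have [] := Hu k.
  rewrite -[leRHS]invrK lef_pV2 ?posrE ?invr_gt0// ltW//.
  rewrite (@lt_le_trans _ _ k%:R) ?ler_nat//.
  by near: k; exact: nbhs_infty_gtr.
have := sf z u uz => /cvgrPdist_lt/(_ e e0)[N _ /(_ N (leqnn N))] /=.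
by have [_] := Hu N; rewrite ltNge => ->.
Unshelve. all: by end_near. Qed.

(** Only [t = 0] is delicate: the exponent [a - 1] is positive, so the power tends to 0 from the
    right and meets the truncation. *)
Lemma continuous_tpow (a : R) : 1 < a -> continuous (tpow a).
Proof.
move=> a1 t; have a0 : 0 < a - 1 by rewrite subr_gt0.
have [t0|t0|t0] := ltgtP t 0.
- rewrite /continuous_at tpow0 ?(ltW t0)//.
  apply: cvg_near_cst; near=> s; rewrite tpow0//.
  by near: s; apply: filterS (lt_nbhsl t0) => s; exact: ltW.
- rewrite /continuous_at tpowE//.
  have pt : {for t, continuous (fun x : R => x `^ (a - 1))}.
    apply/differentiable_continuous/derivable1_diffP.
    by apply: derivable_powR; rewrite in_itv/= t0.
  apply: cvg_trans pt.
  apply: near_eq_cvg; near=> s; rewrite tpowE//.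
  by near: s; exact: lt_nbhsr.
- rewrite t0; apply/left_right_continuousP; split; rewrite tpow0//.
    by apply: cvg_near_cst; near=> s; rewrite tpow0.
  apply: (@cvg_trans _ ((fun x : R => x `^ (a - 1)) x @[x --> 0^'+])); last first.
    exact: powR_cvg0.
  by apply: near_eq_cvg; near=> s; rewrite tpowE.
Unshelve. all: by end_near. Qed.

End continuity.

Section J_source_continuity.
Context {R : realType} {n : nat}.
Local Notation mu := (@lebesgue_measure R).
Implicit Types (z : 'rV[R]_n * R).

Lemma continuous_sqnorm : continuous (@sqnorm R n).
Proof.
move=> x; have Fx : Filter (nbhs x) by exact: nbhs_filter.
apply: (@cvg_big _ _ +%R 0 xpredT (@add_continuous R) _ (nbhs x)) => i _.
apply: (@continuous_cvg _ _ _ (nbhs x) _ (fun y : 'rV[R]_n => y ord0 i)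
  (fun r : R => r ^+ 2)); first exact: exprn_continuous.
exact: coord_continuous.
Qed.

Lemma cvg_damped_conv (c theta : R) z (u : nat -> 'rV[R]_n * R) :
  0 <= c -> 0 <= theta <= 1 -> u k @[k --> \oo] --> z ->
  damped_conv c (u k).1 (Num.max (u k).2 0 * (1 - theta)) (Num.max (u k).2 0 * theta)
    @[k --> \oo] -->
  damped_conv c z.1 (Num.max z.2 0 * (1 - theta)) (Num.max z.2 0 * theta).
Proof.
move=> c0 /andP[th0 th1] uz.
have u1 : sqnorm (u k).1 @[k --> \oo] --> sqnorm z.1.
  apply: (@cvgn_continuous _ _ _ (fun k => (u k).1) _ (@continuous_sqnorm z.1)).
  by apply: cvg_comp uz _; exact: cvg_fst.
have u2 : Num.max (u k).2 0 @[k --> \oo] --> Num.max z.2 0.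
  apply: (@cvgn_continuous _ _ (fun r : R => Num.max r 0) (fun k => (u k).2)).
    by apply: continuous_max; [exact: cvg_id|exact: cvg_cst].
  by apply: cvg_comp uz _; exact: cvg_snd.
have m0 : 0 <= Num.max z.2 0 by rewrite le_max lexx orbT.
(* The clamped time keeps the radicand positive, so the inverse square root is continuous there. *)
have d0 : 0 < 1 + 4 * c * (Num.max z.2 0 * (1 - theta)).
  by rewrite ltr_pwDl// !mulr_ge0// subr_ge0.
have cexp (v : nat -> R) l : v k @[k --> \oo] --> l ->
    expR (- v k) @[k --> \oo] --> expR (- l).
  move=> vl; apply: (@cvgn_continuous _ _ _ (fun k => - v k) _ (@continuous_expR R (- l))).
  exact: cvgN.
have ur : (Num.sqrt (1 + 4 * c * (Num.max (u k).2 0 * (1 - theta))))^-1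
    @[k --> \oo] --> (Num.sqrt (1 + 4 * c * (Num.max z.2 0 * (1 - theta))))^-1.
  apply: cvgV; first by rewrite gt_eqF// sqrtr_gt0.
  apply: (@cvgn_continuous _ _ _ (fun k =>
    1 + 4 * c * (Num.max (u k).2 0 * (1 - theta))) _ (@sqrt_continuous R _)).
  apply: cvgD; first exact: cvg_cst.
  by apply: cvgM; [exact: cvg_cst|apply: cvgM u2 _; exact: cvg_cst].
have cX (v : nat -> R) (l : R) (m : nat) : v k @[k --> \oo] --> l ->
    v k ^+ m @[k --> \oo] --> l ^+ m.
  exact: (@cvgn_continuous _ _ _ v _ (@exprn_continuous R m l)).
apply: cvgM.
  apply: cexp; apply: cvgM; first exact: cvg_cst.
  apply: cvgM; first exact: cvg_cst.
  by apply: cvgM u2 _; exact: cvg_cst.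
apply: cvgM; first exact: cX.
apply: cexp; apply: cvgM; last exact: cX.
by apply: cvgM u1; exact: cvg_cst.
Qed.

(** The prefactor is continuous because [alpha + b > 1]; the profile is, by dominated convergence
    with the Beta integrand as majorant. *)
Lemma continuous_J_source (alpha k b c : R) : 0 < alpha -> 0 < b -> 0 < c ->
  1 < alpha + b -> continuous (@J_source R n alpha k b c).
Proof.
move=> a0 b0 c0 ab1; apply: sequentially_continuous => z u uz.
apply: cvgM.
  apply: cvgM; first exact: cvg_cst.
  apply: (@cvgn_continuous _ _ _ (fun k => (u k).2) _ (@continuous_tpow _ _ ab1 z.2)).
  by apply: cvg_comp uz _; exact: cvg_snd.
have max0 t : 0 <= Num.max t 0 :> R by rewrite le_max lexx orbT.
apply: fine_cvg; rewrite fineK ?profile_fin// ?(ltW c0)//.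
have mP (x : 'rV[R]_n) (t : R) := measurable_profile_integrand alpha b c x t.
have [] // := @dominated_convergence _ _ _ mu setT measurableT
  (fun k theta => (profile_integrand alpha b c (u k).1 (Num.max (u k).2 0) theta)%:E)
  (fun theta => (profile_integrand alpha b c z.1 (Num.max z.2 0) theta)%:E)
  (fun theta => (tpow b theta * tpow alpha (1 - theta))%:E).
- by move=> m; apply/measurable_EFinP; exact: mP.
- by apply/measurable_EFinP; exact: mP.
- apply: aeW => theta _; apply: cvg_EFin; first exact: nearW.
  rewrite /profile_integrand /=.
  have [th0|th0] := leP theta 0.
    by under eq_fun do rewrite tpow0// !mul0r; rewrite tpow0// !mul0r; exact: cvg_cst.
  have [th1|th1] := leP 1 theta.
    under eq_fun do rewrite (@tpow0 _ alpha) ?subr_le0// mulr0 mul0r.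
    by rewrite (@tpow0 _ alpha) ?subr_le0// mulr0 mul0r; exact: cvg_cst.
  apply: cvgM; first exact: cvg_cst.
  by apply: cvg_damped_conv => //; rewrite ?(ltW c0)// (ltW th0) (ltW th1).
- apply/integrableP; split; first by apply/measurable_EFinP; exact: measurable_tpow_conv.
  under eq_integral do rewrite gee0_abs ?lee_fin ?tpow_conv_ge0//.
  by have := eBetaE b0 a0; rewrite /eBeta => ->; exact: ltry.
- apply: aeW => theta m _; rewrite gee0_abs ?lee_fin ?profile_integrand_ge0//.
  exact: profile_integrand_le (ltW c0) (max0 _).
Qed.
End J_source_continuity.

(** * Integrability of the sources *)

Section Xspace_source.
Context {R : realType} {n : nat}.
Local Notation mu := (@lebesgue_measure R).

(** Before time [T], the condition [b >= 1] bounds the power of [t], and dropping the time decay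
    leaves a Gaussian in [x]. The resulting majorant is a bounded function of time on []0, T[] times
    an integrable function of space. *)
Lemma Xspace_source (p k b c : R) : 1 <= p -> 0 <= k -> 1 <= b -> 0 < c ->
  Xspace p (@source R n k b c).
Proof.
move=> p1 k0 b1 c0; have p0 : 0 < p := lt_le_trans ltr01 p1.
split=> [|T]; first exact: measurable_source.
rewrite /finite_norm unlock; apply: poweR_lty.
(* The absolute value keeps the base nonnegative for every [T]; for [T <= 0] the interval []0, T[]
   is empty. *)
pose C := (k * `|T| `^ (b - 1)) `^ p.
pose g (z : 'rV[R]_n * R) := C * \1_(`]0, T[) z.2 * expR (- (c * p * sqnorm z.1)).
have C0 : 0 <= C by exact: powR_ge0.
have g0 z : 0 <= g z by rewrite !mulr_ge0 ?expR_ge0.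
have mg : measurable_fun [set: 'rV[R]_n * R] g.
  apply: measurable_funM.
    apply: measurable_funM => //; apply: measurableT_comp => //.
  apply: measurableT_comp => //; apply: measurableT_comp => //.
  apply: measurable_funM => //.
  by apply: (measurableT_comp (@measurable_sqnorm R n)).
apply: (@le_lt_trans _ _ (\int[lebesgue_spacetime R n]_z (g z)%:E)%E).
  apply: ge0_le_integral => //.
  - by move=> z _; rewrite poweR_ge0.
  - have mf : measurable_fun [set: 'rV[R]_n * R]
        (fun z => if z.2 < T then source k b c z else 0 : R).
      apply: measurable_fun_ifT => //.
        by apply: measurable_fun_ltr => //; exact: measurable_snd.
      exact: measurable_source.
    apply: (@measurableT_comp _ _ _ _ _ _ (fun x : \bar R => x `^ p)%E).
      exact: measurable_poweR.
    by apply: measurableT_comp => //; exact/measurable_EFinP.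
  - by apply/measurable_EFinP.
  move=> [x t] _.
  rewrite -[leLHS]/((`|if t < T then source k b c (x, t) else 0| `^ p)%:E) lee_fin.
  have [tT|tT] := ltP t T; last by rewrite normr0 powR0 ?gt_eqF.
  rewrite ger0_norm ?source_ge0// /source /=.
  have [t0|t0] := leP t 0; first by rewrite tpow0// mulr0 mul0r powR0 ?gt_eqF.
  rewrite /g /= indicE mem_set/= ?in_itv/= ?t0// mulr1.
  rewrite powRM ?mulr_ge0 ?tpow_ge0 ?expR_ge0// ler_pM ?powR_ge0//.
    rewrite ge0_ler_powR ?nnegrE ?mulr_ge0 ?tpow_ge0 ?powR_ge0 ?(ltW p0)//.
    rewrite ler_wpM2l// tpowE// ge0_ler_powR ?nnegrE ?subr_ge0 ?(ltW t0)//.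
    by rewrite (le_trans (ltW tT))// ler_norm.
  rewrite /gauss_damp -expRM ler_expR /= mulNr lerN2 mulrDr mulrDl mulrAC lerDl.
  by rewrite !mulr_ge0// ltW.
rewrite /lebesgue_spacetime fubini_tonelli2//; last first.
  by apply/measurable_EFinP.
have I0 := @integral_rV_gauss_lty R n (c * p) (mulr_gt0 c0 p0).
set I := (\int[_]_x _)%E in I0.
have I_ge0 : (0 <= I)%E by apply: integral_ge0 => x _; rewrite lee_fin expR_ge0.
rewrite (_ : (\int[_]_y _)%E = (\int[mu]_t (C%:E * I * (\1_(`]0, T[) t)%:E))%E).
  rewrite ge0_integralZl//=.
  - rewrite integral_indic// setIT lte_mul_pinfty ?mule_ge0//.
    + by rewrite ge0_fin_numE ?mule_ge0// lte_mul_pinfty.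
    + have : (mu `]0%R, T[%classic < +oo)%E.
        by rewrite lebesgue_measure_itv/=; case: ifP => _ //; rewrite -EFinB ltry.
      by [].
  - exact/measurable_EFinP.
  - by rewrite mule_ge0.
apply: eq_integral => t _; rewrite /fubini_G /g /=.
transitivity (\int[lebesgue_rV R n]_x ((C * \1_(`]0, T[) t)%:E *
  (expR (- (c * p * sqnorm x)))%:E))%E.
  by apply: eq_integral.
rewrite ge0_integralZl//=.
- by rewrite -/I EFinM muleAC.
- apply/measurable_EFinP; apply: measurableT_comp => //; apply: measurableT_comp => //.
  by apply: measurable_funM => //; exact: measurable_sqnorm.
- by rewrite lee_fin mulr_ge0.
Qed.

End Xspace_source.

(** * The system *)

Section system.
Context {R : realType}.

(** One damping rate that fits both strict gaps. As [exp(-x) >= 1 - x], an exponent [x <= 1 - q/C]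
    ensures [q <= C exp(-x)]; the witness is the smaller of the two admissible rates. *)
Lemma small_damping (A B r s l K : R) : 0 < l -> 0 < K ->
  0 <= r < A -> 0 <= s < B ->
  exists2 e : R, 0 < e & r <= A * expR (- (l * e * K)) /\ s <= B * expR (- (e * K)).
Proof.
move=> l0 K0 /andP[r0 rA] /andP[s0 sB].
have A0 := le_lt_trans r0 rA; have B0 := le_lt_trans s0 sB.
have aux (C q x : R) : 0 < C -> x <= 1 - q / C -> q <= C * expR (- x).
  move=> C0 xq; rewrite mulrC -ler_pdivrMr// (le_trans _ (expR_ge1Dx _))//.
  by rewrite lerBrDr addrC -lerBrDr.
have d1 : 0 < (1 - r / A) / l by rewrite divr_gt0// subr_gt0 ltr_pdivrMr// mul1r.
have d2 : 0 < 1 - s / B by rewrite subr_gt0 ltr_pdivrMr// mul1r.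
exists (Num.min ((1 - r / A) / l) (1 - s / B) / K).
  by rewrite divr_gt0// lt_min d1.
split; apply: aux => //.
  rewrite -mulrA divfK ?gt_eqF// mulrC -ler_pdivlMr// ge_min lexx//.
by rewrite divfK ?gt_eqF// ge_min lexx orbT.
Qed.

Lemma powR_lt (x y r : R) : 0 < r -> 0 < x < y -> 0 <= x `^ r < y `^ r.
Proof.
move=> r0 /andP[x0 xy]; rewrite powR_ge0/=.
by apply: gt0_ltr_powR => //; rewrite nnegrE ltW// (lt_trans x0).
Qed.

Lemma powR_div (x y r : R) : 0 <= x -> 0 <= y -> (x / y) `^ r = x `^ r / y `^ r.
Proof.
by move=> x0 y0; rewrite powRM ?invr_ge0// -(powR_inv1 y0) -powRrM mulN1r powRN.
Qed.

Lemma gauss_damp_powR n (c s : R) (z : 'rV[R]_n * R) :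
  gauss_damp c z `^ s = gauss_damp (s * c) z.
Proof. by rewrite /gauss_damp -expRM; congr expR; ring. Qed.

Lemma gauss_damp_le n (c d : R) (z : 'rV[R]_n * R) : c <= d -> 0 <= z.2 ->
  gauss_damp d z <= gauss_damp c z.
Proof.
move=> cd z0; rewrite /gauss_damp ler_expR lerN2 ler_wpM2r//.
by rewrite addr_ge0 ?sqnorm_ge0// !mulr_ge0.
Qed.

Lemma is_frac_heat_J_source n (p alpha k b c : R) : 1 <= p -> 0 < alpha ->
  0 <= k -> 1 <= b -> 0 < c ->
  is_frac_heat p alpha (@J_source R n alpha k b c) (source k b c).
Proof.
move=> p1 a0 k0 b1 c0; split; first exact: Xspace_source.
by apply: aeW => z; rewrite J_source_eq// (lt_le_trans ltr01).
Qed.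

Lemma Yspace_J_source n (p alpha k b c : R) : 1 <= p -> 0 < alpha ->
  0 <= k -> 1 <= b -> 0 < c -> Yspace p alpha (@J_source R n alpha k b c).
Proof.
move=> p1 a0 k0 b1 c0; exists (source k b c); first exact: Xspace_source.
by have [] := @is_frac_heat_J_source n p alpha k b c p1 a0 k0 b1 c0.
Qed.

(** Both sides equal [G2^(l/(1-ls)) G1^(ls/(1-ls))]. This is the balance of amplitudes in one
    equation of the system; exchanging roles gives the other. *)
Lemma powR_amplitude (l s G1 G2 : R) : 0 < l -> 0 < s -> l * s < 1 ->
  0 < G1 -> 0 < G2 ->
  (G2 * G1 `^ (1 / l)) `^ (l / (1 - l * s)) / G1 =
  ((G1 * G2 `^ (1 / s)) `^ (s / (1 - l * s))) `^ l.
Proof.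
move=> l0 s0 ls1 G10 G20.
have D0 : 1 - l * s != 0 by rewrite gt_eqF// subr_gt0.
have l0' : l != 0 by rewrite gt_eqF.
have s0' : s != 0 by rewrite gt_eqF.
have -> : G1^-1 = G1 `^ (-1) by rewrite powR_inv1// ltW.
rewrite !powRM ?powR_ge0 ?(ltW G10) ?(ltW G20)// -!powRrM -mulrA.
rewrite -powRD ?(gt_eqF G10) ?implybT// mulrC.
by congr (_ `^ _ * _ `^ _); field; rewrite ?D0 ?l0' ?s0'.
Qed.

(* Covers both inequalities of the system: [d = l e] in the first; in the second
   [l e <= d] because [lambda * sigma < 1]. *)
Lemma source_le_powR n (beta k' b' e l k b d : R) (z : 'rV[R]_n * R) :
  0 < beta -> 0 <= k' -> 0 < b' -> 0 < e -> 0 < l -> l * e <= d -> 0 <= k ->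
  k <= (k' * (Gamma b' / Gamma (beta + b'))) `^ l ->
  b - 1 = l * (beta + b' - 1) ->
  0 <= source k b d z <= J_source beta k' b' e z `^ l.
Proof.
move=> be0 k'0 b'0 e0 l0 led k0 kle bE; rewrite source_ge0//=.
have [z0|z0] := leP z.2 0; first by rewrite /source tpow0// mulr0 mul0r powR_ge0.
have B0 : 0 <= k' * (Gamma b' / Gamma (beta + b')).
  by rewrite mulr_ge0// divr_ge0// ltW// Gamma_gt0// addr_gt0.
have H := J_source_ge z be0 k'0 b'0 e0.
set C := k' * _ in kle B0 H.
have Ct0 : 0 <= C * tpow (beta + b') z.2 by rewrite mulr_ge0 ?tpow_ge0.
have P0 : 0 <= C * tpow (beta + b') z.2 * gauss_damp e z.
  by rewrite mulr_ge0 ?expR_ge0.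
(* Raise the lower bound of [J_source_ge] to the power [l] and compare factors: amplitudes by [kle],
   powers of time by [bE], Gaussians by [led]. *)
apply: (@le_trans _ _ ((C * tpow (beta + b') z.2 * gauss_damp e z) `^ l)); last first.
  by rewrite ge0_ler_powR ?nnegrE ?(ltW l0)// (le_trans P0).
rewrite powRM ?expR_ge0// powRM ?tpow_ge0// gauss_damp_powR /source.
rewrite !tpowE// -powRrM bE (mulrC l).
rewrite ler_pM ?mulr_ge0 ?powR_ge0 ?expR_ge0//; last first.
  by apply: gauss_damp_le => //; exact: ltW.
by rewrite ler_wpM2r// powR_ge0.
Qed.

Lemma J_source0_ge n (alpha k b c t : R) : 0 < alpha -> 0 <= k -> 0 < b -> 0 < c ->
  0 < t ->
  k * (Gamma b / Gamma (alpha + b)) * expR (- (c * (2 * n%:R * t))) *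
    t `^ (alpha + b - 1) <= J_source alpha k b c (0 : 'rV[R]_n, t).
Proof.
move=> a0 k0 b0 c0 t0; apply: le_trans (J_source_ge _ a0 k0 b0 c0).
rewrite /= tpowE// mulrAC /gauss_damp /= /sqnorm big1 ?add0r// => i _.
by rewrite mxE expr0n.
Qed.

End system.

Theorem theorem2p3 (R : realType) (n : nat) (p q lambda sigma alpha beta : R)
  (hn : (1 <= n)%N) (hp : 1 <= p) (hq : 1 <= q)
  (hlambda : 0 < lambda) (hsigma : 0 < sigma)
  (halpha : 0 < alpha) (hbeta : 0 < beta)
  (hpalpha : (1 < p /\ 0 < alpha < (n%:R + 2) / (2 * p)) \/
             (p = 1 /\ 0 < alpha <= (n%:R + 2) / (2 * p)))
  (hqbeta : (1 < q /\ 0 < beta < (n%:R + 2) / (2 * q)) \/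
            (q = 1 /\ 0 < beta <= (n%:R + 2) / (2 * q)))
  (hsl : sigma < 1 / lambda) :
  let gamma1 := (beta + alpha * sigma) * lambda / (1 - lambda * sigma) in
  let gamma2 := (alpha + beta * lambda) * sigma / (1 - lambda * sigma) in
  let M1 := (Gamma (gamma1 + 1) * Gamma (gamma2 + 1) `^ (1 / sigma)) /
    (Gamma (alpha + gamma1 + 1) * Gamma (beta + gamma2 + 1) `^ (1 / sigma)) in
  let M2 := (Gamma (gamma2 + 1) * Gamma (gamma1 + 1) `^ (1 / lambda)) /
    (Gamma (beta + gamma2 + 1) * Gamma (alpha + gamma1 + 1) `^ (1 / lambda)) in
  forall T N1 N2 : R, 0 < T -> 0 < N1 < M1 -> 0 < N2 < M2 ->
  exists u v : 'rV[R]_n * R -> R,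
    [/\ Yspace p alpha u /\ continuous u,
        Yspace q beta v /\ continuous v,
        exists f g : 'rV[R]_n * R -> R,
          [/\ is_frac_heat p alpha u f,
              is_frac_heat q beta v g,
              \forall z \ae lebesgue_spacetime R n, 0 <= f z <= v z `^ lambda &
              \forall z \ae lebesgue_spacetime R n, 0 <= g z <= u z `^ sigma],
        forall (x : 'rV[R]_n) (t : R), t < 0 -> u (x, t) = 0 /\ v (x, t) = 0 &
        forall t : R, 0 < t < T ->
          N2 `^ (lambda / (1 - lambda * sigma)) * t `^ (gamma2 / sigma)
            <= u (0, t) /\
          N1 `^ (sigma / (1 - lambda * sigma)) * t `^ (gamma1 / lambda)
            <= v (0, t)].

Proof.
move=> gamma1 gamma2 M1 M2 T N1 N2 T0 /andP[N10 N1M] /andP[N20 N2M].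
have ls1 : lambda * sigma < 1 by rewrite mulrC -ltr_pdivlMr.
have D0 : 0 < 1 - lambda * sigma by rewrite subr_gt0.
have D0' : 1 - lambda * sigma != 0 by rewrite gt_eqF.
have g10 : 0 < gamma1 by rewrite divr_gt0// mulr_gt0// addr_gt0// mulr_gt0.
have g20 : 0 < gamma2 by rewrite divr_gt0// mulr_gt0// addr_gt0// mulr_gt0.
(* These two relations balance the powers of [t] in the two equations. *)
have g1E : gamma1 = lambda * (beta + gamma2) by rewrite /gamma1 /gamma2; field.
have g2E : gamma2 = sigma * (alpha + gamma1) by rewrite /gamma1 /gamma2; field.
have g11 : 1 <= gamma1 + 1 by rewrite lerDr ltW.
have g21 : 1 <= gamma2 + 1 by rewrite lerDr ltW.
have g1p : 0 < gamma1 + 1 by exact: lt_le_trans g11.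
have g2p : 0 < gamma2 + 1 by exact: lt_le_trans g21.
pose G1 := Gamma (gamma1 + 1) / Gamma (alpha + (gamma1 + 1)).
pose G2 := Gamma (gamma2 + 1) / Gamma (beta + (gamma2 + 1)).
have G10 : 0 < G1 by rewrite divr_gt0 ?Gamma_gt0 ?addr_gt0.
have G20 : 0 < G2 by rewrite divr_gt0 ?Gamma_gt0 ?addr_gt0.
have Gp x : 0 < x -> 0 <= Gamma x by move=> x0; rewrite ltW// Gamma_gt0.
have M1E : M1 = G1 * G2 `^ (1 / sigma).
  rewrite /M1 /G1 /G2 -!addrA powR_div ?Gp ?addr_gt0//.
  by rewrite invfM mulrACA.
have M2E : M2 = G2 * G1 `^ (1 / lambda).
  rewrite /M2 /G1 /G2 -!addrA powR_div ?Gp ?addr_gt0//.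
  by rewrite invfM mulrACA.
pose A := M2 `^ (lambda / (1 - lambda * sigma)).
pose B := M1 `^ (sigma / (1 - lambda * sigma)).
have AE : A / G1 = B `^ lambda.
  by rewrite /A /B M1E M2E; exact: powR_amplitude.
(* The same identity with [lambda], [sigma] and [G1], [G2] exchanged. *)
have BE : B / G2 = A `^ sigma.
  rewrite /A /B M1E M2E (mulrC lambda); apply: powR_amplitude => //.
  by rewrite mulrC.
have M10 : 0 < M1 := lt_trans N10 N1M.
have M20 : 0 < M2 := lt_trans N20 N2M.
have A0 : 0 < A by exact: powR_gt0.
have B0 : 0 < B by exact: powR_gt0.
have n0 : 0 < n%:R :> R by rewrite ltr0n.
have K0 : 0 < 2 * n%:R * T by rewrite !mulr_gt0.
have := powR_lt (divr_gt0 hlambda D0) (introT andP (conj N20 N2M)).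
rewrite -/A => N2A.
have := powR_lt (divr_gt0 hsigma D0) (introT andP (conj N10 N1M)).
rewrite -/B => N1B.
clearbody A B M1 M2.
(* At [x = 0] and time [T] the damping exponents of [u] and [v] are [lambda * e * (2nT)] and
   [e * (2nT)]; [e] is small enough for the damped [A] and [B] to stay above the required
   constants. *)
have [e e0 [eA eB]] := small_damping hlambda K0 N2A N1B.
have le0 : 0 < lambda * e by exact: mulr_gt0.
have AG0 : 0 <= A / G1 := divr_ge0 (ltW A0) (ltW G10).
have BG0 : 0 <= B / G2 := divr_ge0 (ltW B0) (ltW G20).
have ab1 : 1 < alpha + (gamma1 + 1) by rewrite addrA ltrDr addr_gt0.
have bb1 : 1 < beta + (gamma2 + 1) by rewrite addrA ltrDr addr_gt0.
have AG : A / G1 * G1 = A := divfK (lt0r_neq0 G10) A.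
have BG : B / G2 * G2 = B := divfK (lt0r_neq0 G20) B.
(* Damping [u] at rate [lambda * e] and [v] at rate [e] makes the source of [u] match the Gaussian
   in [v^lambda] exactly. *)
exists (J_source alpha (A / G1) (gamma1 + 1) (lambda * e)).
exists (J_source beta (B / G2) (gamma2 + 1) e); split.
- by split; [exact: Yspace_J_source|exact: continuous_J_source].
- by split; [exact: Yspace_J_source|exact: continuous_J_source].
- exists (source (A / G1) (gamma1 + 1) (lambda * e)), (source (B / G2) (gamma2 + 1) e).
  split; [exact: is_frac_heat_J_source|exact: is_frac_heat_J_source| |].
  + apply: aeW => z; apply: source_le_powR => //; first by rewrite -/G2 BG AE.
    by rewrite addrA !addrK.
  + apply: aeW => z; apply: source_le_powR => //.
    * by rewrite mulrA ler_piMl ?(ltW e0)// mulrC ltW.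
    * by rewrite -/G1 AG BE.
    * by rewrite addrA !addrK.
- by move=> x t t0; split; apply: J_source_le0; exact: ltW.
move=> t /andP[t0 tT].
have g2s : gamma2 / sigma = alpha + (gamma1 + 1) - 1.
  by rewrite addrA addrK g2E mulrC mulKf ?gt_eqF.
have g1l : gamma1 / lambda = beta + (gamma2 + 1) - 1.
  by rewrite addrA addrK g1E mulrC mulKf ?gt_eqF.
(* The damping decreases in time, so the bounds obtained at [T] hold at every earlier [t]. *)
have damp c x y : 0 < c -> 0 <= y -> x <= y * expR (- (c * (2 * n%:R * T))) ->
    x <= y * expR (- (c * (2 * n%:R * t))).
  move=> c0 y0 /le_trans; apply; rewrite ler_wpM2l// ler_expR lerN2.
  by rewrite !ler_wpM2l ?ltW// mulr_gt0.
split.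
- rewrite g2s; apply: le_trans (J_source0_ge _ _ _ _ _ _) => //.
  by rewrite -/G1 AG ler_wpM2r ?powR_ge0// damp// ltW.
- rewrite g1l; apply: le_trans (J_source0_ge _ _ _ _ _ _) => //.
  by rewrite -/G2 BG ler_wpM2r ?powR_ge0// damp// ltW.
Qed.
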